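(* Under Assumptions 1–3, assume $r_\ell<\min\{m_\ell,n_\ell\}$ for all $\ell$. If $0<\beta_1\le1$, $\tau\ge\frac{64}{3\beta_1\underline\delta}$, and $0<\eta\le\min\Big\{\frac1{4L},\sqrt{\frac{3\underline\delta\beta_1^2}{80L^2}},\sqrt{\frac{3\underline\delta}{80\tau^2L^2}},\sqrt{\frac{3\beta_1}{16\tau L^2}}\Big\}$, then GoLore using small-batch stochastic gradients and MSGD with momentum projection satisfies, for every integer $K\ge1$, $\frac1{K\tau}\sum_{t=0}^{K\tau-1}\mathbb{E}\|\nabla f(x^{(t)})\|_2^2\le\frac{16\Delta}{\underline\delta\eta K\tau}+\frac{32\beta_1\sigma^2}{3\underline\delta}.$
   Context: Parameters $x=(\mathrm{vec}(X_1)^\top,\dots,\mathrm{vec}(X_{N_L})^\top)^\top\in\mathbb{R}^d$, $X_\ell\in\mathbb{R}^{m_\ell\times n_\ell}$; $f(x)=\mathbb{E}_{\xi\sim\mathcal D}F(x;\xi)$; $\nabla_\ell$ is the gradient w.r.t. $X_\ell$. Assumption 1: $\inf f>-\infty$. Assumption 2: $\nabla f$ is $L$-Lipschitz in $\|\cdot\|_2$. Assumption 3: $\mathbb{E}_\xi[\nabla_\ell F(x;\xi)]=\nabla_\ell f(x)$ and $\mathbb{E}_\xi\|\nabla_\ell F(x;\xi)-\nabla_\ell f(x)\|_F^2\le\sigma_\ell^2$ for all $x,\ell$; $\sigma^2=\sum_\ell\sigma_\ell^2$. $\Delta=f(x^{(0)})-\inf f$, $\delta_\ell=r_\ell/\min\{m_\ell,n_\ell\}$,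 $\underline\delta=\min_\ell\delta_\ell$. $\mathcal U(\mathrm{St}_{m,r})$ is the uniform (Haar) distribution on $\mathrm{St}_{m,r}=\{P\in\mathbb{R}^{m\times r}:P^\top P=I_r\}$. Algorithm: $M_\ell^{(-1)}=0$. For $t\ge0$ draw $\xi^{(t)}\sim\mathcal D$ independently, $G_\ell^{(t)}=\nabla_\ell F(x^{(t)};\xi^{(t)})$. If $t\equiv0\pmod\tau$ sample $P_\ell^{(t)}\sim\mathcal U(\mathrm{St}_{m_\ell,r_\ell})$, $Q_\ell^{(t)}\sim\mathcal U(\mathrm{St}_{n_\ell,r_\ell})$ independently of everything else; otherwise $P_\ell^{(t)}=P_\ell^{(t-1)}$, $Q_\ell^{(t)}=Q_\ell^{(t-1)}$. If $m_\ell\le n_\ell$: $M_\ell^{(t)}=(1-\beta_1)(P_\ell^{(t)})^\top P_\ell^{(t-1)}M_\ell^{(t-1)}+\beta_1(P_\ell^{(t)})^\top G_\ell^{(t)}$, $X_\ell^{(t+1)}=X_\ell^{(t)}-\eta P_\ell^{(t)}M_\ell^{(t)}$. If $m_\ell>n_\ell$: $M_\ell^{(t)}=(1-\beta_1)M_\ell^{(t-1)}(Q_\ell^{(t-1)})^\top Q_\ell^{(t)}+\beta_1G_\ell^{(t)}Q_\ell^{(t)}$, $X_\ell^{(t+1)}=X_\ell^{(t)}-\eta M_\ell^{(t)}(Q_\ell^{(t)})^\top$. *)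

(* Defs.v *)
From HB Require Import structures.
From mathcomp Require Import all_boot all_order all_algebra.
From mathcomp Require Import all_classical all_reals all_analysis.
Set Implicit Arguments. Unset Strict Implicit. Unset Printing Implicit Defensive.
Import Order.TTheory GRing.Theory Num.Theory.
Import numFieldNormedType.Exports.
Local Open Scope classical_set_scope.
Local Open Scope ring_scope.

Section Params.
Variables (R : realType) (NL : nat) (m n : 'I_NL -> nat).

Definition param := forall l : 'I_NL, 'M[R]_(m l, n l).

Definition padd (x y : param) : param := fun l => x l + y l.
Definition psub (x y : param) : param := fun l => x l - y l.
Definition pscale (a : R) (x : param) : param := fun l => a *: x l.

Definition frob2 p q (A : 'M[R]_(p, q)) : R := \sum_i \sum_j A i j ^+ 2.
Definition pnorm2 (x : param) : R := \sum_l frob2 (x l).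
Definition pinner (x y : param) : R :=
  \sum_l \sum_i \sum_j x l i j * y l i j.

Definition is_gradient (h : param -> R) (g : param -> param) : Prop :=
  forall x v : param,
    is_derive (0 : R) (1 : R) (fun t : R => h (padd x (pscale t v))) (pinner (g x) v).

Definition lipschitz2 (L : R) (g : param -> param) : Prop :=
  forall x y : param,
    Num.sqrt (pnorm2 (psub (g x) (g y))) <= L * Num.sqrt (pnorm2 (psub x y)).
End Params.

(* The GoLore iteration, as a deterministic function of a sample path. *)
Section Golore.
Variables (R : realType) (NL : nat) (m n r : 'I_NL -> nat).
Variable Xi : Type.
Variables (beta eta : R) (tau : nat).
Variable gF : @param R NL m n -> Xi -> @param R NL m n.
Variable x0 : @param R NL m n.

(* state of layer l at time t: X_l^(t), and the momentum M_l^(t-1),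
   which is r x n if m <= n and m x r if m > n (the unused one stays 0) *)
Record lstate (p q k : nat) := LState {
  lX : 'M[R]_(p, q); lML : 'M[R]_(k, q); lMR : 'M[R]_(p, k) }.

Definition lstep (p q k : nat) (P Pprev : 'M[R]_(p, k)) (Q Qprev : 'M[R]_(q, k))
  (G : 'M[R]_(p, q)) (s : lstate p q k) : lstate p q k :=
  if (p <= q)%N then
    let M := (1 - beta) *: (P^T *m Pprev *m lML s) + beta *: (P^T *m G) in
    LState (lX s - eta *: (P *m M)) M (lMR s)
  else
    let M := (1 - beta) *: (lMR s *m Qprev^T *m Q) + beta *: (G *m Q) in
    LState (lX s - eta *: (M *m Q^T)) (lML s) M.

(* xis t = xi^(t);  Pd k l, Qd k l = the projections drawn at time k*tau *)
Variable xis : nat -> Xi.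
Variable Pd : nat -> forall l : 'I_NL, 'M[R]_(m l, r l).
Variable Qd : nat -> forall l : 'I_NL, 'M[R]_(n l, r l).

Definition Pt (t : nat) := Pd (t %/ tau)%N.
Definition Qt (t : nat) := Qd (t %/ tau)%N.

Fixpoint golore_state (t : nat) : forall l : 'I_NL, lstate (m l) (n l) (r l) :=
  match t with
  | 0 => fun l => LState (x0 l) 0 0
  | t'.+1 =>
    let s := golore_state t' in
    let x : @param R NL m n := fun l => lX (s l) in
    let G := gF x (xis t') in
    fun l => lstep (Pt t' l) (Pt t'.-1 l) (Qt t' l) (Qt t'.-1 l) (G l) (s l)
  end.

Definition golore_x (t : nat) : @param R NL m n := fun l => lX (golore_state t l).
End Golore.

Section Prob.
Variables (R : realType) (dO : measure_display) (Omega : measurableType dO).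
Variable (P : probability Omega R).

Definition mx_events p q : set (set 'M[R]_(p, q)) :=
  <<s [set S | exists (i : 'I_p) (j : 'I_q) (A : set R),
                 measurable A /\ S = [set M : 'M[R]_(p, q) | A (M i j)]] >>.

Definition sigma_mx p q (X : Omega -> 'M[R]_(p, q)) : set (set Omega) :=
  [set X @^-1` B | B in @mx_events p q].
Definition sigma_rv dX (Xi : measurableType dX) (Y : Omega -> Xi)
  : set (set Omega) := [set Y @^-1` B | B in measurable].

Definition mutually_independent (I : eqType) (F : I -> set (set Omega)) : Prop :=
  forall (J : seq I) (A : I -> set Omega),
    uniq J -> (forall i, i \in J -> F i (A i)) ->
    P (\bigcap_(i in [set i | i \in J]) A i) = (\prod_(i <- J) fine (P (A i)))%:E.

Definition measurable_mx p q (X : Omega -> 'M[R]_(p, q)) : Prop :=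
  forall i j, measurable_fun setT (fun w => X w i j).

(* X ~ U(St_{p,k}): X takes values in St_{p,k} and its law is the
   (unique) probability measure invariant under left multiplication by
   orthogonal p x p matrices, i.e. the Haar measure on St_{p,k} *)
Definition uniform_stiefel p k (X : Omega -> 'M[R]_(p, k)) : Prop :=
  measurable_mx X /\
  (forall w, (X w)^T *m X w = 1%:M) /\
  (forall U : 'M[R]_p, U^T *m U = 1%:M ->
     forall B, @mx_events p k B ->
       P (X @^-1` B) = P ((fun w => U *m X w) @^-1` B)).
End Prob.

Definition delta_l (R : realType) (rl ml nl : nat) : R := rl%:R / (minn ml nl)%:R.

Definition golore_sigmas (R : realType) (dO : measure_display) (Omega : measurableType dO)
  (NL : nat) (m n r : 'I_NL -> nat) dX (Xi : measurableType dX)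
  (xi : nat -> Omega -> Xi)
  (Pd : nat -> forall l : 'I_NL, Omega -> 'M[R]_(m l, r l))
  (Qd : nat -> forall l : 'I_NL, Omega -> 'M[R]_(n l, r l))
  (i : ((nat + (nat * 'I_NL)) + (nat * 'I_NL))%type) : set (set Omega) :=
  match i with
  | inl (inl t) => sigma_rv (xi t)
  | inl (inr kl) => sigma_mx (Pd kl.1 kl.2)
  | inr kl => sigma_mx (Qd kl.1 kl.2)
  end.

(* Main.v *)
(** In terms of the lifted momentum [P M] (resp. [M Q^T]) one step reads
    m_t = Pi_k ((1 - beta) m_(t-1) + beta G_t), x_(t+1) = x_t - eta m_t, where Pi_k is
    the orthogonal projection of the period k = t / tau.  Everything except three
    expectations is pathwise: with g_t the gradient and n_t the noise,
    - |m_t - g_t|^2 = |m_t - Pi_k g_t|^2 + |(1 - Pi_k) g_t|^2;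
    - the first term contracts at rate 1 - beta, up to steps |x_(t+1) - x_t|^2, the
      gradient at the start of each period, and beta <u_t, n_t>, beta^2 |n_t|^2 with
      u_t = Pi_k (m_(t-1) - g_t);
    - the second term is compared with |(1 - Pi_k) g_(k tau)|^2;
    - smoothness of f supplies enough -|x_(t+1) - x_t|^2 to absorb all the steps.
    It remains to use E <u_t, n_t> = 0, E |n_t|^2 <= sigma^2 and, by Haar invariance
    (E P P^T = (r / m) I), E |(1 - Pi_k) g_(k tau)|^2 <= (1 - delta) E |g_(k tau)|^2.
    For the first and the last, Fubini is applied to a pair (past, fresh draw), the
    past being Omega with the sigma-algebra generated by all the other draws.  Joint
    measurability of the stochastic gradient comes from differentiability along
    lines. *)
Require Import Defs.
From HB Require Import structures.
From mathcomp Require Import all_boot all_order all_algebra.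
From mathcomp Require Import perm.
From mathcomp Require Import all_classical all_reals all_analysis.
From mathcomp Require Import measurable_realfun ring lra.
Import Order.TTheory GRing.Theory Num.Theory.
Import numFieldNormedType.Exports.
Local Open Scope classical_set_scope.
Local Open Scope ring_scope.

(** The obstacle is that inside a period the iterates depend on Pi_k, so Haar invariance controls
    the residual only at time k tau, the last iterate computed before Pi_k is drawn. Every other
    time of the period is reached through the drift of x, which is why squared steps enter with a
    factor tau^2. A refresh also destroys the alignment of the momentum with the sampled subspace:
    the error in the new subspace can jump by |g_(k tau)|^2. This is paid once per period; spread
    over tau steps and divided by the contraction rate beta, it costs a multiple 2 / (beta tau) of
    the sum of |g_t|^2, which the lower bound on tau keeps below 3 delta / 32. The residual leaves a
    margin delta / 2 for it. The cross terms <u_t, n_t> and the excess of the residual at k tau over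
    its expected share have no sign on a given path. They enter the pathwise bound linearly with
    nonrandom coefficients, so expectations can be taken at the very end. *)

Lemma big_nat_blocks (R : nmodType) (F : nat -> R) (K tau : nat) :
  \sum_(0 <= t < K * tau) F t =
  \sum_(0 <= k < K) \sum_(0 <= j < tau) F (k * tau + j)%N.
Proof.
elim: K => [|K IH]; first by rewrite mul0n !big_geq.
rewrite big_nat_recr //= -IH mulSn addnC.
rewrite (big_cat_nat _ (leq_addr _ _)) //=; congr (_ + _).
by rewrite -{1}[(K * tau)%N]add0n big_addn addKn; apply: eq_bigr => i _; rewrite addnC.
Qed.

(** * Pathwise analysis of the recursion *)

Section PathwiseDescent.
Variables (R : realFieldType) (V : lmodType R) (ip : V -> V -> R).
Hypothesis ipC : forall a b, ip a b = ip b a.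
Hypothesis ipDl : forall a b c, ip (a + b) c = ip a c + ip b c.
Hypothesis ipZl : forall k a b, ip (k *: a) b = k * ip a b.
Hypothesis ip_ge0 : forall a, 0 <= ip a a.

Let nrm a := ip a a.

Let ipDr a b c : ip c (a + b) = ip c a + ip c b.
Proof. by rewrite ipC ipDl !(ipC c). Qed.
Let ipZr k a b : ip a (k *: b) = k * ip a b.
Proof. by rewrite ipC ipZl ipC. Qed.
Let ipNl a b : ip (- a) b = - ip a b.
Proof. by rewrite -scaleN1r ipZl mulN1r. Qed.
Let ipNr a b : ip a (- b) = - ip a b.
Proof. by rewrite ipC ipNl ipC. Qed.
Let ip0 a : ip 0 a = 0.
Proof. by rewrite -(scale0r 0) ipZl mul0r. Qed.
Let ipE := (ipDl, ipDr, ipNl, ipNr, ipZl, ipZr).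

Let nrmN a : nrm (- a) = nrm a.
Proof. by rewrite /nrm !ipE opprK. Qed.

Let young (c : R) a b : 0 < c ->
  nrm (a + b) <= (1 + c) * nrm a + (1 + c^-1) * nrm b.
Proof.
(* Multiplied by [c], the difference of the two sides is exactly |c a - b|^2. *)
move=> c0; have := ip_ge0 (c *: a - b).
rewrite /nrm !ipE (ipC b a) => h.
rewrite -(ler_pM2l c0).
have -> : c * ((1 + c) * ip a a + (1 + c^-1) * ip b b)
  = (c + c * c) * ip a a + (c + 1) * ip b b by field; lra.
nra.
Qed.

(** Cauchy-Schwarz for a telescoping sum. In the induction, Young's inequality with weight 1 / j
    turns the factor j into (1 + 1 / j) j = j + 1 on the old steps and gives 1 + j on the new
    one. *)
Let nrm_telescope (x : nat -> V) (j : nat) :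
  nrm (x j - x 0%N) <= j%:R * \sum_(0 <= i < j) nrm (x i.+1 - x i).
Proof.
elim: j => [|j IH]; first by rewrite subrr /nrm ip0 mul0r.
rewrite big_nat_recr //=.
case: j IH => [|j] IH; first by rewrite big_geq // add0r mul1r.
set S := \sum_(0 <= i < _) _ in IH *.
have j0 : (0 : R) < j.+1%:R by rewrite ltr0n.
have -> : x j.+2 - x 0%N = (x j.+1 - x 0%N) + (x j.+2 - x j.+1).
  by rewrite [RHS]addrC addrA subrK.
have c0 : 0 < j.+1%:R^-1 :> R by rewrite invr_gt0.
apply: le_trans (young _ (x j.+1 - x 0%N) (x j.+2 - x j.+1) c0) _.
rewrite invrK -[j.+2%:R]natr1.
have : (1 + j.+1%:R^-1) * nrm (x j.+1 - x 0%N)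
    <= (1 + j.+1%:R^-1) * (j.+1%:R * S).
  by rewrite ler_pM2l // addr_gt0 ?invr_gt0.
have -> : (1 + j.+1%:R^-1) * (j.+1%:R * S) = (j.+1%:R + 1) * S.
  by rewrite mulrA mulrDl mulVf ?gt_eqF // mul1r.
by move=> h; rewrite mulrDr; apply: lerD => //; rewrite addrC.
Qed.

(** The boundary term [(1 - beta) * a T] is what the recursion consumes at the next step; it makes
    the induction close. *)
Let le_discounted_sum (beta : R) (a s : nat -> R) :
  a 0%N <= s 0%N -> (forall t, a t.+1 <= (1 - beta) * a t + s t.+1) ->
  forall T, beta * \sum_(0 <= t < T.+1) a t + (1 - beta) * a T
    <= \sum_(0 <= t < T.+1) s t.
Proof.
move=> h0 hS; elim => [|T IH]; first by rewrite !big_nat1; lra.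
rewrite [X in _ * X]big_nat_recr // [X in _ <= X]big_nat_recr //=.
by have := hS T; lra.
Qed.

Variables (x g n mt : nat -> V) (Pi : nat -> V -> V) (fx : nat -> R).
Variables (tau : nat) (beta eta L delta Delta : R).
Hypothesis PiD : forall k a b, Pi k (a + b) = Pi k a + Pi k b.
Hypothesis PiZ : forall k c a, Pi k (c *: a) = c *: Pi k a.
Hypothesis Pi_sym : forall k a b, ip (Pi k a) b = ip a (Pi k b).
Hypothesis Pi_idem : forall k a, Pi k (Pi k a) = Pi k a.
Hypothesis mt0 : mt 0%N = 0.
Hypothesis mtS : forall t,
  mt t.+1 = Pi (t %/ tau)%N ((1 - beta) *: mt t + beta *: (g t + n t)).
Hypothesis xS : forall t, x t.+1 = x t - eta *: mt t.+1.
Hypothesis g_lip : forall s t, nrm (g s - g t) <= L ^+ 2 * nrm (x s - x t).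
Hypothesis descent : forall t,
  fx t.+1 <= fx t + ip (g t) (x t.+1 - x t) + L / 2 * nrm (x t.+1 - x t).
Hypothesis fx_gap : forall t, fx 0%N - fx t <= Delta.
Hypotheses (beta0 : 0 < beta) (beta1 : beta <= 1).
Hypotheses (eta0 : 0 < eta) (delta0 : 0 < delta) (delta1 : delta <= 1).
Hypothesis tau0 : (0 < tau)%N.
Hypothesis tau_large : 64 / (3 * beta * delta) <= tau%:R.
Hypothesis eta_L : 4 * (eta * L) <= 1.
Hypothesis eta_beta : 80 * (L ^+ 2 * eta ^+ 2) <= 3 * delta * beta ^+ 2.
Hypothesis eta_tau : 80 * (tau%:R ^+ 2 * (L ^+ 2 * eta ^+ 2)) <= 3 * delta.
Hypothesis eta_tau_beta : 16 * (tau%:R * (L ^+ 2 * eta ^+ 2)) <= 3 * beta.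

Let u t := Pi (t %/ tau)%N (mt t - g t).
Let N t := nrm (g t).
Let d t := nrm (x t.+1 - x t).
Let a t := nrm (mt t.+1 - Pi (t %/ tau)%N (g t)).
Let b t := nrm (g t - Pi (t %/ tau)%N (g t)).
Let z t := 2 * beta * (1 - beta) * ip (u t) (n t) + beta ^+ 2 * nrm (n t).
(** Excess of the residual at the start of period [k] over its expected share: no sign on a path,
    nonpositive in mean. *)
Let y k := nrm (g (k * tau)%N - Pi k (g (k * tau)%N)) - (1 - delta) * N (k * tau)%N.

Let PiN k v : Pi k (- v) = - Pi k v.
Proof. by rewrite -scaleN1r PiZ scaleN1r. Qed.

(** [v - Pi k w] lies in the range of the projection and [w - Pi k w] is orthogonal to it. *)
Let pythagoras k v w : Pi k v = v -> nrm (v - w) = nrm (v - Pi k w) + nrm (w - Pi k w).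
Proof.
move=> hv; rewrite /nrm !ipE.
have e1 : ip v (Pi k w) = ip v w by rewrite -Pi_sym hv.
have e2 : ip (Pi k w) (Pi k w) = ip (Pi k w) w by rewrite -Pi_sym Pi_idem.
rewrite !(ipC w) !(ipC (Pi k w) v) e1 e2; ring.
Qed.

Let nrm_Pi k v : nrm (Pi k v) <= nrm v.
Proof.
have := ip_ge0 (v - Pi k v); rewrite /nrm !ipE.
have -> : ip (Pi k v) (Pi k v) = ip (Pi k v) v by rewrite -Pi_sym Pi_idem.
by rewrite (ipC v); lra.
Qed.

Let Pi_mt t : Pi (t %/ tau)%N (mt t.+1) = mt t.+1.
Proof. by rewrite mtS Pi_idem. Qed.

Let a_le t : a t <= (1 - beta) ^+ 2 * nrm (u t) + z t.
Proof.
have -> : a t = nrm ((1 - beta) *: u t + beta *: Pi (t %/ tau)%N (n t)).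
  congr nrm; rewrite mtS /u !PiD !PiZ !PiD PiN scalerBr scalerDr.
  rewrite [(1 - beta) *: Pi _ (g t)]scalerBl scale1r opprB !addrA.
  by rewrite [LHS]addrAC.
have e : ip (u t) (Pi (t %/ tau)%N (n t)) = ip (u t) (n t).
  by rewrite -Pi_sym /u Pi_idem.
have := nrm_Pi (t %/ tau)%N (n t); rewrite /nrm /z !ipE (ipC _ (u t)) e.
by have := sqr_ge0 beta; rewrite /nrm; nra.
Qed.

(** The target moves from [g s] to [g s.+1] within one subspace. Weight [beta] in Young's inequality
    is affordable thanks to the factor (1 - beta)^2 that [a_le] puts in front. *)
Let mt_shift_le s : nrm (mt s.+1 - Pi (s %/ tau)%N (g s.+1)) <=
  (1 + beta) * a s + (1 + beta^-1) * (L ^+ 2 * d s).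
Proof.
have -> : mt s.+1 - Pi (s %/ tau)%N (g s.+1) =
   (mt s.+1 - Pi (s %/ tau)%N (g s)) + Pi (s %/ tau)%N (g s - g s.+1).
  by rewrite PiD PiN addrA subrK.
apply: le_trans (young _ _ _ beta0) _; rewrite lerD2l ler_pM2l; last first.
  by rewrite addr_gt0 ?invr_gt0.
apply: le_trans (nrm_Pi _ _) _; apply: le_trans (g_lip _ _) _.
by rewrite -nrmN opprB.
Qed.

(** Inside a period the projection is unchanged and fixes [mt s.+1]. At a refresh only the
    contractivity of the new projection is available; the full error is then split by the old
    projection, whose complement contributes at most |g|^2. *)
Let u_le s : nrm (u s.+1) <=
  nrm (mt s.+1 - Pi (s %/ tau)%N (g s.+1)) + (tau %| s.+1)%:R * N s.+1.
Proof.
case: (boolP (tau %| s.+1)%N) => [_|ndiv].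
  rewrite mul1r; apply: le_trans (nrm_Pi _ _) _.
  rewrite (pythagoras (s %/ tau)%N _ (g s.+1) (Pi_mt s)) lerD2l.
  (* Pythagoras at [v = 0]: |g|^2 = |Pi g|^2 + |g - Pi g|^2. *)
  rewrite /N -[X in _ <= X]nrmN -[X in _ <= nrm X]add0r.
  rewrite (pythagoras (s %/ tau)%N 0 (g s.+1)); last first.
    by rewrite -(scale0r 0) PiZ !scale0r.
  by rewrite lerDr; apply: ip_ge0.
rewrite mul0r addr0 /u divnS // (negbTE ndiv) add0n PiD PiN Pi_mt.
by [].
Qed.

(* [(1 - beta)^2 (1 + beta) <= 1 - beta] and [(1 - beta)^2 (1 + 1 / beta) <= 1 / beta] *)
Let a_rec s : a s.+1 <= (1 - beta) * a s +
  (L ^+ 2 / beta * d s + (tau %| s.+1)%:R * N s.+1 + z s.+1).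
Proof.
have [? ?] := (beta0, beta1).
apply: le_trans (a_le _) _.
have h := le_trans (u_le s) (lerD (mt_shift_le s) (lexx _)).
have b1 : 0 <= (1 - beta) ^+ 2 by apply: sqr_ge0.
have := ler_wpM2l b1 h.
have as0 : 0 <= a s by apply: ip_ge0.
have ds0 : 0 <= L ^+ 2 * d s by rewrite mulr_ge0 ?sqr_ge0 //; apply: ip_ge0.
have N0 : 0 <= (tau %| s.+1)%:R * N s.+1 by rewrite mulr_ge0 //; apply: ip_ge0.
have e1 : (1 - beta) ^+ 2 * (1 + beta) <= 1 - beta.
  have : 0 <= (1 - beta) * beta ^+ 2 by rewrite mulr_ge0 ?sqr_ge0 ?subr_ge0.
  by lra.
have e2 : (1 - beta) ^+ 2 * (1 + beta^-1) <= beta^-1.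
  have -> : (1 - beta) ^+ 2 * (1 + beta^-1) = (1 - beta) ^+ 2 * (1 + beta) / beta.
    by field; rewrite gt_eqF.
  rewrite ler_piMl ?invr_ge0 ?(ltW beta0) //.
  by apply: le_trans e1 _; rewrite gerBl ltW.
have e3 : (1 - beta) ^+ 2 <= 1.
  have : 0 <= beta * (2 - beta) by rewrite mulr_ge0 //; lra.
  by lra.
have := ler_wpM2r as0 e1; have := ler_wpM2r ds0 e2; have := ler_wpM2r N0 e3.
have -> : L ^+ 2 / beta * d s = beta^-1 * (L ^+ 2 * d s).
  by rewrite mulrAC mulrC.
move: (nrm (u _)) (beta^-1) (a s) (z _) (L ^+ 2 * d s) (_%:R * N _).
by move=> *; lra.
Qed.

Let sum_a T : beta * \sum_(0 <= t < T) a t <=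
  L ^+ 2 / beta * \sum_(0 <= t < T) d t +
  \sum_(0 <= t < T) (tau %| t)%:R * N t + \sum_(0 <= t < T) z t.
Proof.
have [? ?] := (beta0, beta1).
have d0 t : 0 <= d t by apply: ip_ge0.
have c0 : 0 <= L ^+ 2 / beta by rewrite divr_ge0 ?sqr_ge0 ?ltW.
case: T => [|T]; first by rewrite !big_geq // !mulr0 !addr0.
(* The displacement of step t' is charged to the error at time t' + 1, so time 0 carries none. *)
pose s t := (if t is t'.+1 then L ^+ 2 / beta * d t' else 0)
            + (tau %| t)%:R * N t + z t.
have h0 : a 0%N <= s 0%N.
  (* As [mt 0] vanishes, the initial error is at most |g_0|^2 plus noise: time 0 counts as a
     refresh, consistently with tau dividing 0. *)
  rewrite /s add0r dvdn0 mul1r; apply: le_trans (a_le _) _; rewrite lerD2r.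
  apply: (@le_trans _ _ (nrm (u 0%N))).
    rewrite ler_piMl //; first by apply: ip_ge0.
    have : 0 <= beta * (2 - beta) by rewrite mulr_ge0 //; lra.
    by lra.
  by apply: le_trans (nrm_Pi _ _) _; rewrite mt0 sub0r nrmN.
have := le_discounted_sum beta a s h0 a_rec T.
have aT0 : 0 <= (1 - beta) * a T by rewrite mulr_ge0 ?subr_ge0 //; apply: ip_ge0.
have -> : \sum_(0 <= t < T.+1) s t = L ^+ 2 / beta * \sum_(0 <= t < T) d t +
    \sum_(0 <= t < T.+1) (tau %| t)%:R * N t + \sum_(0 <= t < T.+1) z t.
  by rewrite /s !big_split /= big_nat_recl //= add0r -mulr_sumr.
move=> h.
have : L ^+ 2 / beta * \sum_(0 <= i < T) d i <=
       L ^+ 2 / beta * \sum_(0 <= i < T.+1) d i.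
  by apply: ler_wpM2l => //; rewrite big_nat_recr //= lerDl.
by lra.
Qed.

Let block_dist k j : (j < tau)%N ->
  nrm (x (k * tau + j)%N - x (k * tau)%N) <=
  tau%:R * \sum_(0 <= i < tau) d (k * tau + i)%N.
Proof.
move=> jt; have := nrm_telescope (fun i => x (k * tau + i)%N) j.
rewrite addn0 => /le_trans; apply.
have d0 t : 0 <= d t by apply: ip_ge0.
apply: ler_pM; rewrite ?ler0n ?ler_nat ?(ltnW jt) //.
  by apply: sumr_ge0 => i _; apply: ip_ge0.
rewrite (big_cat_nat (leq0n j) (ltnW jt)) /=.
under eq_bigr do rewrite addnS.
by rewrite lerDl sumr_ge0.
Qed.

Let block_N k j : (j < tau)%N -> N (k * tau)%N <=
  2 * N (k * tau + j)%N +
  2 * (L ^+ 2 * (tau%:R * \sum_(0 <= i < tau) d (k * tau + i)%N)).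
Proof.
move=> jt; rewrite /N.
have -> : g (k * tau)%N =
  g (k * tau + j)%N + (g (k * tau)%N - g (k * tau + j)%N).
  by rewrite addrC subrK.
apply: le_trans (young _ _ _ ltr01) _; rewrite invr1 lerD2l ler_pM2l //.
apply: le_trans (g_lip _ _) _.
by rewrite ler_wpM2l ?sqr_ge0 // -nrmN opprB; apply: block_dist.
Qed.

(** The residual is carried back to the start of the period, where [y] and 1 - delta come in, and
    |g|^2 is carried forward again because the final sum runs over all times. Both transfers use the
    weight c = delta / 4, for which (1 + c)^2 (1 - delta) <= 1 - delta / 2: half of the gain
    survives. *)
Let block_b k j : (j < tau)%N -> b (k * tau + j)%N <=
  (1 + delta / 4) * y k + (1 - delta / 2) * N (k * tau + j)%N +
  8 / delta * (L ^+ 2 * (tau%:R * \sum_(0 <= i < tau) d (k * tau + i)%N)).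
Proof.
move=> jt; have [? ?] := (delta0, delta1).
set S := L ^+ 2 * _; set c := delta / 4.
have c0 : 0 < c by rewrite divr_gt0.
have gS : nrm (g (k * tau + j)%N - g (k * tau)%N) <= S.
  apply: le_trans (g_lip _ _) _; rewrite ler_wpM2l ?sqr_ge0 //.
  exact: block_dist.
have S0 : 0 <= S by apply: le_trans gS; apply: ip_ge0.
rewrite /b divnMDl // divn_small // addn0.
set p := Pi k.
have bP v : nrm (v - p v) <= nrm v.
  rewrite /nrm !ipE; have -> : ip (p v) (p v) = ip (p v) v.
    by rewrite -Pi_sym Pi_idem.
  have -> : ip (p v) v = ip (p v) (p v) by rewrite -[in RHS]Pi_sym Pi_idem.
  have -> : ip v (p v) = ip (p v) (p v) by rewrite -Pi_sym -[in RHS]Pi_sym Pi_idem.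
  by have := ip_ge0 (p v); lra.
set g0 := g (k * tau)%N in gS *; set gt := g (k * tau + j)%N in gS *.
have h1 : nrm (gt - p gt) <= (1 + c) * nrm (g0 - p g0) + (1 + c^-1) * S.
  have -> : gt - p gt = (g0 - p g0) + ((gt - g0) - p (gt - g0)).
    have -> : (gt - g0) - p (gt - g0) = (gt - p gt) - (g0 - p g0).
      by rewrite /p PiD PiN !opprD !opprK addrACA.
    by rewrite [RHS]addrC subrK.
  apply: le_trans (young _ _ _ c0) _; rewrite lerD2l ler_pM2l.
    exact: le_trans (bP _) gS.
  by rewrite addr_gt0 ?invr_gt0.
have h2 : nrm g0 <= (1 + c) * nrm gt + (1 + c^-1) * S.
  have -> : g0 = gt + (g0 - gt) by rewrite addrC subrK.
  apply: le_trans (young _ _ _ c0) _; rewrite lerD2l ler_pM2l.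
    by rewrite -nrmN opprB.
  by rewrite addr_gt0 ?invr_gt0.
have yE : nrm (g0 - p g0) = y k + (1 - delta) * nrm g0 by rewrite /y subrK.
rewrite yE in h1; apply: le_trans h1 _.
have N0 : 0 <= nrm gt by apply: ip_ge0.
have e1 : (1 + c) * (1 - delta) * (1 + c) <= 1 - delta / 2.
  have : 0 <= delta ^+ 2 * (7 + delta) by rewrite mulr_ge0 ?sqr_ge0; lra.
  by rewrite /c; lra.
have ci : delta * c^-1 = 4 by rewrite /c; field; rewrite gt_eqF.
have e2 : (1 + c) * (1 - delta) * (1 + c^-1) + (1 + c^-1) <= 8 / delta.
  rewrite ler_pdivlMr // /c invf_div.
  have -> : ((1 + delta / 4) * (1 - delta) * (1 + 4 / delta) + (1 + 4 / delta)) * delta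
    = (delta + 4) * ((1 + delta / 4) * (1 - delta) + 1) by field; rewrite gt_eqF.
  have : 0 <= delta * (1 + delta) by rewrite mulr_ge0 //; lra.
  have : 0 <= delta ^+ 3 by rewrite exprn_ge0 // ltW.
  by have := sqr_ge0 delta; lra.
have h3 : (1 + c) * (1 - delta) * nrm g0 <=
  (1 + c) * (1 - delta) * ((1 + c) * nrm gt + (1 + c^-1) * S).
  by rewrite ler_wpM2l // mulr_ge0 //; lra.
have := ler_wpM2r N0 e1; have := ler_wpM2r S0 e2.
rewrite -/(N _) /N -/gt.
by move: (c^-1) (8 / delta) (nrm gt) (nrm g0) h3 => *; lra.
Qed.

(** Each gradient at a refresh is compared with all tau gradients of its period; this averaging is
    the source of the factor 1 / tau. *)
Let sum_N_starts K :
  tau%:R * \sum_(0 <= t < K * tau) (tau %| t)%:R * N t <=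
  2 * \sum_(0 <= t < K * tau) N t +
  2 * (L ^+ 2 * tau%:R ^+ 2 * \sum_(0 <= t < K * tau) d t).
Proof.
rewrite !big_nat_blocks !mulr_sumr -big_split /=.
apply: ler_sum => k _.
have -> : \sum_(0 <= j < tau) (tau %| k * tau + j)%:R * N (k * tau + j)%N
    = N (k * tau)%N.
  rewrite (big_ltn tau0) addn0 dvdn_mull // mul1r big_nat big1 ?addr0 // => j.
  by case/andP=> j0 jt; rewrite dvdn_addr ?dvdn_mull // gtnNdvd // mul0r.
have -> : tau%:R * N (k * tau)%N = \sum_(0 <= j < tau) N (k * tau)%N.
  by rewrite sumr_const_nat subn0 mulr_natl.
set S := \sum_(0 <= i < tau) d _.
have -> : 2 * (L ^+ 2 * tau%:R ^+ 2 * S) =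
    \sum_(0 <= j < tau) 2 * (L ^+ 2 * (tau%:R * S)).
  by rewrite sumr_const_nat subn0 -mulr_natl; ring.
rewrite mulr_sumr -big_split /= big_nat [X in _ <= X]big_nat.
by apply: ler_sum => j /andP[_ jt]; apply: block_N.
Qed.

Let sum_b K :
  \sum_(0 <= t < K * tau) b t <=
  tau%:R * (1 + delta / 4) * \sum_(0 <= k < K) y k +
  (1 - delta / 2) * \sum_(0 <= t < K * tau) N t +
  8 / delta * (L ^+ 2 * tau%:R ^+ 2 * \sum_(0 <= t < K * tau) d t).
Proof.
rewrite !big_nat_blocks !mulr_sumr -!big_split /=.
apply: ler_sum => k _; set S := \sum_(0 <= i < tau) d _.
have -> : tau%:R * (1 + delta / 4) * y k = \sum_(0 <= j < tau) (1 + delta / 4) * y k.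
  by rewrite sumr_const_nat subn0 -[RHS]mulr_natl mulrA.
have -> : 8 / delta * (L ^+ 2 * tau%:R ^+ 2 * S) =
    \sum_(0 <= j < tau) 8 / delta * (L ^+ 2 * (tau%:R * S)).
  rewrite sumr_const_nat subn0 -mulr_natl; move: (8 / delta) => *; ring.
rewrite mulr_sumr -!big_split /= big_nat [X in _ <= X]big_nat.
by apply: ler_sum => j /andP[_ jt]; apply: block_b.
Qed.

(** With x_(t+1) - x_t = - eta m, polarization writes 2 <g, m> as |g|^2 + |m|^2 - |m - g|^2, and
    Pythagoras splits |m - g|^2 into a + b. The factor 3 / 4 is the lower bound of 1 - eta L. *)
Let sum_descent T :
  \sum_(0 <= t < T) N t + 3 / 4 * eta ^- 2 * \sum_(0 <= t < T) d t <=
  2 * Delta / eta + \sum_(0 <= t < T) a t + \sum_(0 <= t < T) b t.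
Proof.
have e0 := eta0; have eL := eta_L.
have step t : N t + 3 / 4 * eta ^- 2 * d t <=
   2 / eta * (fx t - fx t.+1) + a t + b t.
  have xE : x t.+1 - x t = (- eta) *: mt t.+1.
    by rewrite xS addrAC subrr add0r scaleNr.
  have abE : a t + b t = nrm (mt t.+1 - g t).
    by rewrite (pythagoras _ _ (g t) (Pi_mt t)).
  have := descent t; rewrite -[_ + a t + b t]addrA abE /d xE /nrm !ipE (ipC _ (g t)) /N /nrm.
  set p := ip (g t) (mt _); set q := ip (mt _) _; set G := ip (g t) _.
  have q0 : 0 <= q by apply: ip_ge0.
  have e2 : 0 < eta / 2 by rewrite divr_gt0.
  move=> h; rewrite -(ler_pM2l e2).
  have -> : eta / 2 * (G + 3 / 4 * eta ^- 2 * (- eta * (- eta * q)))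
    = eta / 2 * G + 3 / 8 * (eta * q) by field; rewrite gt_eqF.
  rewrite [eta / 2 * (2 / eta * _ + _)]mulrDr.
  have -> : eta / 2 * (2 / eta * (fx t - fx t.+1)) = fx t - fx t.+1.
    by field; rewrite gt_eqF.
  have := ler_wpM2r (mulr_ge0 (ltW e0) q0) eL.
  by lra.
have -> : \sum_(0 <= t < T) N t + 3 / 4 * eta ^- 2 * \sum_(0 <= t < T) d t
  = \sum_(0 <= t < T) (N t + 3 / 4 * eta ^- 2 * d t).
  by rewrite mulr_sumr -big_split.
apply: le_trans (ler_sum _ (fun t _ => step t)) _.
rewrite !big_split /= -!addrA lerD2r -mulr_sumr.
have -> : \sum_(0 <= t < T) (fx t - fx t.+1) = fx 0%N - fx T.
  rewrite -[RHS]opprB -(telescope_sumr fx (leq0n T)) -sumrN.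
  by apply: eq_bigr => i _; rewrite opprB.
by rewrite -mulrA [Delta / eta]mulrC mulrA ler_pM2l ?divr_gt0.
Qed.

(** The noise part of [sum_a] is divided by [beta], which leaves beta |n|^2: this is why the final
    variance term is proportional to beta. *)
Lemma pathwise_gradient_bound K :
  delta / 8 * \sum_(0 <= t < K * tau) ip (g t) (g t) <=
  2 * Delta / eta +
  \sum_(0 <= t < K * tau)
    (2 * (1 - beta) * ip (Pi (t %/ tau)%N (mt t - g t)) (n t) + beta * ip (n t) (n t)) +
  tau%:R * (1 + delta / 4) *
  \sum_(0 <= k < K) (ip (g (k * tau)%N - Pi k (g (k * tau)%N))
                        (g (k * tau)%N - Pi k (g (k * tau)%N))
                     - (1 - delta) * ip (g (k * tau)%N) (g (k * tau)%N)).
Proof.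
set Z := \sum_(0 <= t < _) (_ * _ + _).
have bn0 : beta != 0 by rewrite gt_eqF.
have en0 : eta != 0 by rewrite gt_eqF.
have dn0 : delta != 0 by rewrite gt_eqF.
have zE : \sum_(0 <= t < K * tau) z t = beta * Z.
  by rewrite /Z mulr_sumr; apply: eq_bigr => t _; rewrite /z /nrm; ring.
have h1 := sum_descent (K * tau); have h2 := sum_b K.
have h3 := sum_a (K * tau); have h4 := sum_N_starts K.
rewrite zE in h3.
move: h1 h2 h3 h4; rewrite -/(N _) -/(y _).
set SN := \sum_(0 <= t < _) N t; set SD := \sum_(0 <= t < _) d t.
set SA := \sum_(0 <= t < _) a t; set SB := \sum_(0 <= t < _) b t.
set SY := \sum_(0 <= t < _) y t; set SS := \sum_(0 <= t < _) _ * N t.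
move=> h1 h2 h3 h4.
have SN0 : 0 <= SN by apply: sumr_ge0 => t _; apply: ip_ge0.
have SD0 : 0 <= SD by apply: sumr_ge0 => t _; apply: ip_ge0.
have t0 : (0 : R) < tau%:R by rewrite ltr0n.
have b0 := beta0; have e0 := eta0; have dl0 := delta0.
have h5 : SA <= L ^+ 2 / beta ^+ 2 * SD + Z +
    (2 / (beta * tau%:R) * SN + 2 * (L ^+ 2 * tau%:R / beta) * SD).
  rewrite -(ler_pM2l b0); apply: (le_trans h3).
  have h6 : SS <= 2 / tau%:R * SN + 2 * (L ^+ 2 * tau%:R * SD).
    rewrite -(ler_pM2l t0); apply: (le_trans h4).
    by rewrite le_eqVlt; apply/orP; left; apply/eqP; field; rewrite gt_eqF.
  have -> : beta * (L ^+ 2 / beta ^+ 2 * SD + Z +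
     (2 / (beta * tau%:R) * SN + 2 * (L ^+ 2 * tau%:R / beta) * SD)) =
     L ^+ 2 / beta * SD + (2 / tau%:R * SN + 2 * (L ^+ 2 * tau%:R * SD)) + beta * Z.
    by field; rewrite bn0 gt_eqF.
  by rewrite lerD2r lerD2l.
(* Of the margin delta / 2 left by [sum_b], the refreshes take at most 3 delta / 32; the remaining
   13 delta / 32 exceeds delta / 8. *)
have c1 : 2 / (beta * tau%:R) <= 3 / 32 * delta.
  rewrite ler_pdivrMr ?mulr_gt0 //.
  move: tau_large; rewrite ler_pdivrMr ?mulr_gt0 // => h.
  by lra.
have e2 : 0 < eta ^+ 2 by rewrite exprn_gt0.
(* Three step-size conditions bound the drifts by 3 / 80, 30 / 80 and 24 / 80 times eta^-2: in total
   57 / 80, against the 60 / 80 supplied by the descent. *)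
have c2 : L ^+ 2 / beta ^+ 2 + 2 * (L ^+ 2 * tau%:R / beta)
   + 8 / delta * (L ^+ 2 * tau%:R ^+ 2) <= 3 / 4 * eta ^- 2.
  have p1 : L ^+ 2 / beta ^+ 2 <= 3 / 80 * eta ^- 2.
    rewrite ler_pdivrMr ?exprn_gt0 // mulrAC ler_pdivlMr //.
    apply: (@le_trans _ _ (3 / 80 * delta * beta ^+ 2)).
      by move: eta_beta; lra.
    by rewrite ler_wpM2r ?sqr_ge0 // ler_piMr.
  have p2 : L ^+ 2 * tau%:R / beta <= 3 / 16 * eta ^- 2.
    rewrite ler_pdivrMr // [X in _ <= X]mulrAC ler_pdivlMr //.
    by move: eta_tau_beta; lra.
  have p3 : 8 / delta * (L ^+ 2 * tau%:R ^+ 2) <= 24 / 80 * eta ^- 2.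
    rewrite [X in X <= _]mulrAC ler_pdivrMr // [X in _ <= X]mulrAC ler_pdivlMr //.
    by move: eta_tau; lra.
  have : 0 <= eta ^- 2 by rewrite invr_ge0 ltW.
  by move: (eta ^- 2) (L ^+ 2 / _) (_ / beta) (8 / delta * _) p1 p2 p3 => *; lra.
suff : delta / 8 * SN <= 2 * Delta / eta + Z + tau%:R * (1 + delta / 4) * SY by [].
have c4 := ler_wpM2r SN0 c1.
have c3 : L ^+ 2 / beta ^+ 2 * SD + 2 * (L ^+ 2 * tau%:R / beta) * SD
   + 8 / delta * (L ^+ 2 * tau%:R ^+ 2) * SD <= 3 / 4 * eta ^- 2 * SD.
  by rewrite -!mulrDl; apply: ler_wpM2r.
rewrite [8 / delta * (L ^+ 2 * tau%:R ^+ 2 * SD)]mulrA in h2.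
move: h1 h2 h5 c3 c4.
move: (2 / (beta * tau%:R) * SN) => X1.
move: (L ^+ 2 / beta ^+ 2 * SD) (2 * (L ^+ 2 * tau%:R / beta) * SD) => X3 X4.
move: (8 / delta * (L ^+ 2 * tau%:R ^+ 2) * SD) (3 / 4 / eta ^+ 2 * SD) => X5 X6.
move: (2 * Delta / eta) (tau%:R * (1 + delta / 4) * SY) => X7 X8.
have := mulr_ge0 (ltW dl0) SN0.
by lra.
Qed.
End PathwiseDescent.

(** * Smooth and Gateaux differentiable functions *)

Lemma is_derive_translate (R : realType) (phi : R -> R) (t d : R) :
  is_derive (0 : R) (1 : R) (fun s => phi (t + s)) d -> is_derive t (1 : R) phi d.
Proof.
move=> [h1 h2].
have E : (fun h : R => h^-1 *: ((phi \o shift t) (h *: (1 : R)) - phi t)) =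
  (fun h : R => h^-1 *: (((fun s => phi (t + s)) \o shift 0) (h *: (1 : R))
                         - phi (t + 0))).
  by apply/funext => h /=; rewrite !addr0 [t + _]addrC.
split; first by move: h1; rewrite /derivable /= -E.
by move: h2; rewrite /derive /= -E.
Qed.

(** A sequence of increments, so that measurability passes from the quotients to the derivative. *)
Lemma cvg_difference_quotient (R : realType) (phi : R -> R) (d : R) :
  is_derive (0 : R) (1 : R) phi d ->
  (n.+1%:R * (phi n.+1%:R^-1 - phi 0)) @[n --> \oo] --> d.
Proof.
move=> [h1 h2].
have : (fun h : R => h^-1 *: ((phi \o shift 0) (h *: (1 : R)) - phi 0)) @ 0^' --> d.
  by rewrite -h2; exact: h1.
move=> /cvgr_dnbhsP /(_ (fun n => n.+1%:R^-1)).
have hu : (forall n : nat, n.+1%:R^-1 != 0 :> R) /\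
    ((n.+1%:R^-1 : R) @[n --> \oo] --> (0 : R)).
  by split=> [n|]; [rewrite invr_neq0|exact: cvg_harmonic].
have -> : (fun n : nat => n.+1%:R * (phi n.+1%:R^-1 - phi 0)) =
  (fun n : nat => (n.+1%:R^-1)^-1 *: ((phi \o shift 0) (n.+1%:R^-1 *: (1 : R)) - phi 0)).
  by apply/funext => n /=; rewrite invrK addr0 /GRing.scale /= mulr1.
by move=> /(_ hu).
Qed.

(** * Joint measurability from continuity along lines *)

Section CoordinateContinuity.
Variables (R : realType) (V : lmodType R).
Variables (dX : measure_display) (X : measurableType dX) (I : Type) (e : I -> V).
Variable h : V -> X -> R.
Hypothesis h_meas : forall v, measurable_fun setT (h v).
Hypothesis h_cont : forall v i s, continuous (fun t : R => h (v + t *: e i) s).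

Let q (k : nat) (r : R) : R := (Num.floor (r * k.+1%:R))%:~R / k.+1%:R.

Let q_cvg (r : R) : q k r @[k --> \oo] --> r.
Proof.
apply/cvgrPdist_le => eps eps0.
have := @cvg_harmonic R => /cvgrPdist_le /(_ _ eps0).
apply: filterS => k; rewrite sub0r normrN => hk.
apply: le_trans hk; rewrite /q.
have k0 : (0 : R) < k.+1%:R by rewrite ltr0n.
rewrite (ger0_norm (_ : 0 <= harmonic k)); last by rewrite /harmonic /= invr_ge0 ltW.
have -> : r - (Num.floor (r * k.+1%:R))%:~R / k.+1%:R =
  (r * k.+1%:R - (Num.floor (r * k.+1%:R))%:~R) / k.+1%:R.
  by rewrite mulrBl mulfK // gt_eqF.
rewrite normrM [X in _ * X]ger0_norm ?invr_ge0 ?(ltW k0) // /harmonic /=.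
rewrite ler_piMl ?invr_ge0 ?(ltW k0) //.
have /andP[h1 h2] := real_floor_itv (num_real (r * k.+1%:R)).
rewrite ger0_norm ?subr_ge0 //.
by move: h2; rewrite intrD; lra.
Qed.

(* Caratheodory: one coordinate at a time, replace the coordinate by a
   countably-valued approximation and use continuity along that line. *)
Lemma measurable_coordinate_continuous (dT : measure_display)
    (T : measurableType dT) (Y : I -> T -> R) (Z : T -> X) (s : seq I) :
  (forall i, measurable_fun setT (Y i)) -> measurable_fun setT Z ->
  forall v, measurable_fun setT
    (fun w => h (v + \sum_(i <- s) Y i w *: e i) (Z w)).
Proof.
move=> mY mZ; elim: s => [|i s IH] v.
  under eq_fun do rewrite big_nil addr0.
  exact: measurableT_comp (h_meas v) mZ.
apply: (@measurable_fun_cvg _ _ _ setT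
  (fun k w => h (v + (q k (Y i w) *: e i + \sum_(j <- s) Y j w *: e j)) (Z w))).
- move=> k.
  (* Level sets of the rounded coordinate, indexed by nat through an enumeration of the integers; an
     index that encodes no integer gives the empty set. *)
  pose E (n : nat) : set T :=
    [set w | Some (Num.floor (Y i w * k.+1%:R)) = unpickle n].
  have ET : \bigcup_n E n = setT.
    apply/seteqP; split => // w _.
    by exists (pickle (Num.floor (Y i w * k.+1%:R))) => //; rewrite /E /= pickleK.
  rewrite -ET; apply/measurable_fun_bigcup => n.
    rewrite /E; case: (unpickle n) => [z|]; last first.
      by rewrite [X in measurable X](_ : _ = set0) //; apply/seteqP; split.
    rewrite [X in measurable X](_ : _ = (fun w => Y i w * k.+1%:R) @^-1`
       [set` `[z%:~R, (z + 1)%:~R[%R]); last first.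
      apply/seteqP; split => w /=.
        by case=> <-; rewrite in_itv /= real_floor_itv ?num_real.
      by rewrite in_itv /= => /floor_def ->.
    rewrite -[X in measurable X]setTI.
    have mm : measurable_fun setT (fun w => Y i w * k.+1%:R).
      by apply: measurable_funM.
    by apply: mm.
  case En : (unpickle n) => [z|]; last first.
    rewrite (_ : E n = set0); first exact: measurable_fun_set0.
    by apply/seteqP; split => // w; rewrite /E /= En.
  (* On a level set the rounded coordinate is a constant, which is absorbed into the base point;
     hence the induction over all [v]. *)
  apply: (@eq_measurable_fun _ _ _ _ _
    (fun w => h (v + (z%:~R / k.+1%:R) *: e i + \sum_(j <- s) Y j w *: e j) (Z w))).
    by move=> w; rewrite inE /E /= En => -[zE]; rewrite addrA /q zE.
  exact: measurable_funTS (IH _).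
- move=> w _; rewrite big_cons.
  set S := \sum_(j <- s) _.
  have E t : v + (t *: e i + S) = (v + S) + t *: e i.
    by rewrite addrAC addrA.
  rewrite E; under eq_fun do rewrite E.
  exact: (cvg_comp _ _ (q_cvg (Y i w)) (h_cont (v + S) i (Z w) (Y i w))).
Qed.
End CoordinateContinuity.

Lemma is_derive_line (R : realType) (V : lmodType R) (h : V -> R)
    (u : V) (d : V -> R) :
  (forall v, is_derive (0 : R) (1 : R) (fun t : R => h (v + t *: u)) (d v)) ->
  forall v (t : R), is_derive t (1 : R) (fun t : R => h (v + t *: u)) (d (v + t *: u)).
Proof.
move=> hd v t; apply: is_derive_translate.
rewrite [X in is_derive _ _ X](_ : _ = fun s : R => h (v + t *: u + s *: u)) //.
by apply/funext => s; rewrite scalerDl addrA.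
Qed.

(** * The quadratic upper bound for functions with Lipschitz gradient *)

Section Descent.
Variables (R : realType) (V : lmodType R) (ip : V -> V -> R).
Hypothesis ipC : forall a b, ip a b = ip b a.
Hypothesis ipDl : forall a b c, ip (a + b) c = ip a c + ip b c.
Hypothesis ipZl : forall k a b, ip (k *: a) b = k * ip a b.
Hypothesis ip_ge0 : forall a, 0 <= ip a a.

(** [psi] is [f] along the segment minus its quadratic upper model. Its derivative is nonpositive on
    (0, 1), so the mean value theorem suffices. *)
Lemma descent_lemma (f : V -> R) (g : V -> V) (L : R) : 0 < L ->
  (forall v u, is_derive (0 : R) (1 : R) (fun t : R => f (v + t *: u)) (ip (g v) u)) ->
  (forall v u, ip (g v - g u) (g v - g u) <= L ^+ 2 * ip (v - u) (v - u)) ->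
  forall v u, f (v + u) <= f v + ip (g v) u + L / 2 * ip u u.
Proof.
move=> L0 hd hl v u.
pose psi (t : R) := f (v + t *: u) - (t * ip (g v) u + L / 2 * ip u u * t ^+ 2).
pose dpsi (t : R) := ip (g (v + t *: u)) u - (ip (g v) u + L * ip u u * t).
have dpsiP (t : R) : is_derive t (1 : R) psi (dpsi t).
  have h1 := @is_derive_line _ _ f u (fun v => ip (g v) u) (hd ^~ u) v t.
  apply: is_deriveB; apply: is_derive_eq.
  by rewrite /GRing.scale /=; lra.
have psi_cont : {within `[0, 1], continuous psi}.
  apply: continuous_subspaceT => t.
  by apply/differentiable_continuous/derivable1_diffP; have [] := dpsiP t.
have [c c01 hc] := MVT (@ltr01 R) (fun t _ => dpsiP t) psi_cont.
have : psi 1 - psi 0 <= 0.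
  rewrite hc subr0 mulr1 /dpsi.
  move: c01; rewrite in_itv /= => /andP[c0 _].
  have := hl (v + c *: u) v.
  have -> : v + c *: u - v = c *: u by rewrite addrAC subrr add0r.
  rewrite ipZl (ipC u) ipZl => h1.
  have [a aE] : exists a, a = g (v + c *: u) - g v by eexists.
  rewrite -aE in h1.
  have ipNl x y : ip (- x) y = - ip x y by rewrite -scaleN1r ipZl mulN1r.
  have ipBr x y z : ip x (y - z) = ip x y - ip x z.
    by rewrite ipC ipDl ipNl !(ipC _ x).
  (* Expanding |a - L c u|^2 >= 0 with |a|^2 <= (L c)^2 |u|^2 gives <a, u> <= L c |u|^2 without
     square roots. *)
  have := ip_ge0 (a - (L * c) *: u).
  have ipZr x k y : ip x (k *: y) = k * ip x y by rewrite ipC ipZl ipC.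
  rewrite ipDl ipNl !ipBr !ipZl !ipZr (ipC u a).
  have -> : ip (g (v + c *: u)) u = ip a u + ip (g v) u by rewrite aE -ipDl subrK.
  move=> h2; have Lc : 0 < L * c by rewrite mulr_gt0.
  rewrite -(pmulr_rle0 _ Lc); lra.
rewrite /psi !scale0r !scale1r addr0 mul0r mul1r expr0n /= expr1n mulr0 mulr1; lra.
Qed.
End Descent.

(** * Independence *)

Section IndependentFubini.
Local Open Scope ereal_scope.
Variables (R : realType) (dO : measure_display) (Omega : measurableType dO).
Variable (P : probability Omega R).
Variables (dT : measure_display) (T : measurableType dT) (A : Omega -> T).
Variables (dE : measure_display) (E : measurableType dE) (W : Omega -> E).
Variable (nu : probability E R).
Hypotheses (mA : measurable_fun setT A) (mW : measurable_fun setT W).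
Hypothesis indep : forall S B, measurable S -> measurable B ->
  P ((A @^-1` S) `&` (W @^-1` B)) = P (A @^-1` S) * nu B.

Let Am : {mfun Omega >-> T} := HB.pack A (isMeasurableFun.Build _ _ _ _ A mA).
Let PA : probability T R := distribution P Am.
Let AW w := (A w, W w).
Let mAW : measurable_fun setT AW.
Proof. exact: measurable_fun_pair. Qed.
Let AWm : {mfun Omega >-> (T * E)%type} :=
  HB.pack AW (isMeasurableFun.Build _ _ _ _ AW mAW).

(** Independence gives the law of the pair on rectangles, and rectangles determine it. *)
Let lawE (S : set (T * E)) : measurable S -> (PA \x nu) S = distribution P AWm S.
Proof. by apply: product_measure_unique => B C mB mC; exact: indep. Qed.

Lemma ge0_integral_independent (h : T * E -> \bar R) :
  measurable_fun setT h -> (forall z, 0 <= h z) ->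
  \int[P]_w h (A w, W w) = \int[P]_w \int[nu]_e h (A w, e).
Proof.
move=> mh h0.
rewrite -[LHS](ge0_integral_distribution AWm) //.
rewrite (eq_measure_integral (PA \x nu)) => [|S mS _]; last exact/esym/lawE.
rewrite fubini_tonelli1 //.
rewrite (ge0_integral_distribution Am) //.
- exact: measurable_fun_fubini_tonelli_F.
- by move=> t; apply: integral_ge0.
Qed.

Lemma integral_independent (h : T * E -> \bar R) :
  measurable_fun setT h -> P.-integrable setT (fun w => h (A w, W w)) ->
  \int[P]_w h (A w, W w) = \int[P]_w \int[nu]_e h (A w, e).
Proof.
move=> mh ih.
have ih' : (PA \x nu).-integrable setT h.
  apply/integrableP; split => //.
  rewrite (eq_measure_integral (distribution P AWm)) => [|S mS _]; last first.
    exact: lawE.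
  have mah : measurable_fun setT (fun z => `|h z|) by exact: measurableT_comp.
  rewrite ge0_integral_distribution //.
  by have /integrableP[] := ih.
rewrite -[LHS](integral_distribution (X := AWm)) //.
rewrite (eq_measure_integral (PA \x nu)) => [|S mS _]; last exact/esym/lawE.
rewrite -integral12_prod_meas1 //.
have iF : PA.-integrable setT (fun t => \int[nu]_e h (t, e)).
  exact: integrable_fubini_F.
have /integrableP[mF Foo] := iF.
apply: (integral_distribution (X := Am)) => //.
apply/integrableP; split; first exact: measurableT_comp.
rewrite -(ge0_integral_distribution Am (f := fun t => `|\int[nu]_e h (t, e)|)) //.
exact: measurableT_comp.
Qed.
End IndependentFubini.

(** * Independence of one draw from all the others *)

Section OtherEvents.
Variables (R : realType) (dO : measure_display) (Omega : measurableType dO).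
Variables (P : probability Omega R) (I : eqType) (Fam : I -> set (set Omega)).
Hypothesis Fam_meas : forall i, Fam i `<=` measurable.
Hypothesis FamI : forall i, setI_closed (Fam i).
Hypothesis indep : mutually_independent P Fam.

(* A pi-system generating the sigma-algebra of all the [Fam i] with [i != i0]. *)
Definition other_events (i0 : I) : set (set Omega) :=
  [set S | exists (J : seq I) (A : I -> set Omega),
     [/\ uniq J, i0 \notin J, (forall i, i \in J -> Fam i (A i))
       & S = \bigcap_(i in [set i | i \in J]) A i]].

Lemma other_events_measurable i0 : other_events i0 `<=` measurable.
Proof.
move=> _ [J [A [_ _ hA ->]]].
elim: J hA => [|k K IH] hA.
  by rewrite (_ : \bigcap_(i in _) _ = setT) //; apply/seteqP; split.
rewrite (_ : \bigcap_(i in _) _ = A k `&` \bigcap_(i in [set i | i \in K]) A i).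
  apply: measurableI; first by apply/(Fam_meas k)/hA; rewrite inE eqxx.
  by apply: IH => i iK; apply: hA; rewrite inE iK orbT.
apply/seteqP; split => [w a|w [ak a] i].
  by split=> [|i iK]; apply: a; rewrite /= inE ?eqxx // (_ : i \in K) ?orbT.
by rewrite /= inE => /predU1P[->//|]; exact: a.
Qed.

Lemma sub_other_events i0 i : i != i0 -> Fam i `<=` other_events i0.
Proof.
move=> ii0 S FS; exists [:: i], (fun=> S); split => //.
- by rewrite inE eq_sym.
- by move=> j; rewrite inE => /eqP ->.
- by apply/seteqP; split => [w Sw j _ //|w]; apply; rewrite /= inE.
Qed.

Lemma other_eventsI i0 : setI_closed (other_events i0).
Proof.
move=> _ _ [J1 [A1 [u1 n1 h1 ->]]] [J2 [A2 [u2 n2 h2 ->]]].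
exists (undup (J1 ++ J2)).
exists (fun i => (if i \in J1 then A1 i else setT) `&`
                 (if i \in J2 then A2 i else setT)).
split.
- exact: undup_uniq.
- by rewrite mem_undup mem_cat negb_or n1.
- move=> i; rewrite mem_undup mem_cat.
  case: ifP => i1; case: ifP => i2 //= _; rewrite ?setTI ?setIT.
  + by apply: FamI; [exact: h1|exact: h2].
  + exact: h1.
  + exact: h2.
- apply/seteqP; split => w.
    move=> [a1 a2] i _; split; case: ifP => // ij; [exact: a1|exact: a2].
  move=> a; split => i ij.
    have : i \in undup (J1 ++ J2) by rewrite mem_undup mem_cat ij.
    by move=> /(a i)[]; rewrite ij.
  have : i \in undup (J1 ++ J2) by rewrite mem_undup mem_cat ij orbT.
  by move=> /(a i)[_]; rewrite ij.
Qed.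

(** Both sides, as functions of [S], are finite measures that agree on the pi-system [other_events],
    hence on the sigma-algebra it generates. *)
Lemma independent_of_others i0 (S B : set Omega) :
  <<s other_events i0 >> S -> Fam i0 B -> (P (S `&` B) = P S * P B)%E.
Proof.
move=> sS FB; have mB := Fam_meas _ _ FB.
have PBfin : (P B = (fine (P B))%:E)%E by rewrite fineK // fin_num_measure.
have PB0 : 0 <= fine (P B) by rewrite fine_ge0.
pose m2 := mscale (NngNum PB0) P.
have m2E S' : (m2 S' = P B * P S')%E by rewrite /m2 /mscale /= -PBfin.
suff -> : P (S `&` B) = m2 S by rewrite m2E muleC.
apply: (g_sigma_algebra_measure_unique (other_events i0) _ (fun=> setT) _ _
  (mrestr P mB) m2) => //.
- exact: other_events_measurable.
- move=> _; exists [::], (fun=> setT); split => //.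
  by rewrite set_nil bigcap_set0.
- by rewrite bigcup_const //; exists 0%N.
- exact: other_eventsI.
- move=> _ [J [A [uJ nJ hA ->]]].
  set SJ := \bigcap_(i in _) _; transitivity (P B * P SJ)%E; last by rewrite -m2E.
  rewrite (indep J A uJ hA) /mrestr /SJ.
  (* Placing [B] at index [i0], which is absent from [J], lets independence be applied to
     [i0 :: J]. *)
  pose A' i := if i == i0 then B else A i.
  have A'E i : i \in J -> A' i = A i.
    by rewrite /A'; case: eqP => // -> iJ; rewrite iJ in nJ.
  have := indep (i0 :: J) A'; rewrite /= nJ uJ => /(_ isT).
  have hA' i : i \in i0 :: J -> Fam i (A' i).
    rewrite inE /A'; case: eqP => [-> //|_ /=]; exact: hA.
  move=> /(_ hA'); rewrite big_cons.
  have -> : \prod_(j <- J) fine (P (A' j)) = \prod_(j <- J) fine (P (A j)).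
    by apply: eq_big_seq => j jJ; rewrite A'E.
  rewrite [A' i0]/A' eqxx EFinM -PBfin => <-; congr (P _).
  apply/seteqP; split => w.
    move=> [a b] i; rewrite /= inE /A'; case: eqP => [_ _ //|_ /=]; exact: a.
  move=> a; split; last first.
    by have := a i0; rewrite /A' eqxx; apply; rewrite /= inE eqxx.
  by move=> i iJ; rewrite -A'E //; apply: a; rewrite /= inE iJ orbT.
- move=> k; rewrite /mrestr /= (le_lt_trans (probability_le1 _ _)) ?ltry //.
  exact: measurableI.
Qed.
End OtherEvents.

Set Implicit Arguments.
Unset Strict Implicit.

(** * Parameters as vectors *)

Section Flatten.
Variables (R : realType) (NL : nat) (m n : 'I_NL -> nat).
Notation param := (@param R NL m n).

(** A single finite index for the entries of all layers turns the dependent family [param] into one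
    module, to which the abstract pathwise estimates apply with [vdot]. *)
Definition pindex : finType := {l : 'I_NL & ('I_(m l) * 'I_(n l))%type}.
Definition pvec := {ffun pindex -> R^o}.

Definition flat (x : param) : pvec :=
  [ffun p : pindex => x (tag p) (tagged p).1 (tagged p).2].
Definition unflat (v : pvec) : param :=
  fun l => \matrix_(i, j) v (Tagged (fun l => ('I_(m l) * 'I_(n l))%type) (i, j)).

Definition vdot (v w : pvec) : R := \sum_p v p * w p.

Definition vbasis (p : pindex) : pvec := [ffun p' => (p' == p)%:R].

Lemma param_ext (x y : param) : (forall l i j, x l i j = y l i j) -> x = y.
Proof. by move=> h; apply: functional_extensionality_dep => l; apply/matrixP. Qed.

Lemma flatK x : unflat (flat x) = x.
Proof. by apply: param_ext => l i j; rewrite mxE ffunE. Qed.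

Lemma unflatK v : flat (unflat v) = v.
Proof. by apply/ffunP => -[l [i j]]; rewrite ffunE mxE. Qed.

Lemma flat_add x y : flat (padd x y) = flat x + flat y.
Proof. by apply/ffunP => p; rewrite !ffunE mxE. Qed.

Lemma flat_sub x y : flat (psub x y) = flat x - flat y.
Proof. by apply/ffunP => p; rewrite !ffunE !mxE. Qed.

Lemma flat_scale a x : flat (pscale a x) = a *: flat x.
Proof. by apply/ffunP => p; rewrite !ffunE mxE. Qed.

Lemma vdotC v w : vdot v w = vdot w v.
Proof. by apply: eq_bigr => p _; rewrite mulrC. Qed.

Lemma vdotDl u v w : vdot (u + v) w = vdot u w + vdot v w.
Proof. by rewrite -big_split /=; apply: eq_bigr => p _; rewrite ffunE mulrDl. Qed.

Lemma vdotZl k v w : vdot (k *: v) w = k * vdot v w.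
Proof. by rewrite mulr_sumr; apply: eq_bigr => p _; rewrite ffunE mulrA. Qed.

Lemma vdot_ge0 v : 0 <= vdot v v.
Proof. by apply: sumr_ge0 => p _; rewrite -expr2 sqr_ge0. Qed.

Lemma pinnerE x y : pinner x y = vdot (flat x) (flat y).
Proof.
rewrite /pinner /vdot.
under eq_bigr do rewrite pair_big /=.
rewrite sig_big_dep /=.
by apply: eq_bigr => p _; rewrite !ffunE.
Qed.

Lemma pnorm2E x : pnorm2 x = vdot (flat x) (flat x).
Proof.
rewrite -pinnerE; apply: eq_bigr => l _; apply: eq_bigr => i _.
by apply: eq_bigr => j _; rewrite expr2.
Qed.

Lemma vdot_basis v p : vdot v (vbasis p) = v p.
Proof.
rewrite /vdot (bigD1 p) //= ffunE eqxx mulr1 big1 ?addr0 // => q qp.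
by rewrite ffunE (negbTE qp) mulr0.
Qed.

Lemma vbasis_sum (v : pvec) : v = \sum_p v p *: vbasis p.
Proof.
apply/ffunP => q; rewrite sum_ffunE.
rewrite -{1}(vdot_basis v q) /vdot; apply: eq_bigr => p _.
by rewrite [RHS]ffunE [X in _ = _ *: X]ffunE [X in _ * X = _]ffunE eq_sym.
Qed.

Lemma is_gradient_flat (h : param -> R) (g : param -> param) :
  is_gradient h g -> forall v u : pvec,
  is_derive (0 : R) (1 : R) (fun t : R => h (unflat (v + t *: u)))
    (vdot (flat (g (unflat v))) u).
Proof.
move=> hg v u; have := hg (unflat v) (unflat u).
rewrite pinnerE unflatK.
rewrite [X in is_derive _ _ X _ -> _](_ : _ = (fun t : R => h (unflat (v + t *: u)))) //.
apply/funext => t; congr h.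
by rewrite -[LHS]flatK flat_add flat_scale !unflatK.
Qed.

(** A coordinate of the gradient is a limit of difference quotients of [h] along a basis vector.
    These are measurable since [h] is measurable in the sample and continuous along coordinate
    lines. *)
Lemma measurable_gradient (dX : measure_display) (X : measurableType dX)
    (h : param -> X -> R) (g : param -> X -> param) :
  (forall s, is_gradient (h ^~ s) (g ^~ s)) ->
  (forall x, measurable_fun setT (h x)) ->
  forall (dT : measure_display) (T : measurableType dT) (Y : T -> param) (Z : T -> X),
  (forall l i j, measurable_fun setT (fun w => Y w l i j)) ->
  measurable_fun setT Z ->
  forall l i j, measurable_fun setT (fun w => g (Y w) (Z w) l i j).
Proof.
move=> hg mh dT T Y Z mY mZ l i j.
pose p : pindex := Tagged (fun l => ('I_(m l) * 'I_(n l))%type) (i, j).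
pose hV v s := h (unflat v) s.
have hVd v u s := is_gradient_flat (hg s) v u.
have mhV (v : pvec) :
    measurable_fun setT (fun w => hV (v + flat (Y w)) (Z w)).
  under eq_fun do rewrite (vbasis_sum (flat (Y _))).
  apply: (measurable_coordinate_continuous _ _ _ _ _ vbasis hV) => //.
  - by move=> v'; exact: mh.
  - move=> v' q s t.
    apply/differentiable_continuous/derivable1_diffP.
    by have [] := is_derive_line _ _ (hV ^~ s) (vbasis q) _ (fun v => hVd v (vbasis q) s) v' t.
  - by move=> q; under eq_fun do rewrite ffunE; exact: mY.
pose phi w (t : R) := hV (flat (Y w) + t *: vbasis p) (Z w).
apply: (@measurable_fun_cvg _ _ _ setT
  (fun k w => k.+1%:R * (phi w k.+1%:R^-1 - phi w 0))).
  move=> k; apply: measurable_funM => //; apply: measurable_funB.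
    under eq_fun do rewrite /phi addrC; exact: mhV.
  under eq_fun do rewrite /phi addrC; exact: mhV.
move=> w _; apply: cvg_difference_quotient.
have := hVd (flat (Y w)) (vbasis p) (Z w).
by rewrite vdot_basis flatK ffunE.
Qed.
End Flatten.

(** * Expectation of real random variables *)

Section RealExpectation.
Variables (R : realType) (dO : measure_display) (Omega : measurableType dO).
Variable (P : probability Omega R).

Definition intg (X : Omega -> R) : Prop := P.-integrable setT (fun w => (X w)%:E).
(** [fine] sends infinite values to 0, so [Ex] is meaningful only together with [intg]. *)
Definition Ex (X : Omega -> R) : R := fine (\int[P]_w (X w)%:E).

Lemma intg_measurable X : intg X -> measurable_fun setT X.
Proof. by move=> /integrableP[] /measurable_EFinP. Qed.

Lemma ExE X : intg X -> (\int[P]_w (X w)%:E = (Ex X)%:E)%E.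
Proof. by move=> iX; rewrite fineK //; exact: integrable_fin_num. Qed.

Lemma intg_cst c : intg (fun=> c).
Proof. exact: finite_measure_integrable_cst. Qed.

Lemma Ex_cst c : Ex (fun=> c) = c.
Proof. by rewrite /Ex integral_cst //= probability_setT mule1. Qed.

Lemma intgD X Y : intg X -> intg Y -> intg (fun w => X w + Y w).
Proof.
by move=> iX iY; have := integrableD measurableT iX iY; rewrite /intg.
Qed.

Lemma ExD X Y : intg X -> intg Y -> Ex (fun w => X w + Y w) = Ex X + Ex Y.
Proof.
move=> iX iY; apply: EFin_inj; rewrite EFinD -!ExE //; last exact: intgD.
by rewrite -integralD.
Qed.

Lemma intgZ c X : intg X -> intg (fun w => c * X w).
Proof. by move=> iX; have := integrableZl measurableT c iX; rewrite /intg. Qed.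

Lemma ExZ c X : intg X -> Ex (fun w => c * X w) = c * Ex X.
Proof.
move=> iX; apply: EFin_inj; rewrite EFinM -!ExE //; last exact: intgZ.
by rewrite -integralZl.
Qed.

Lemma intg_sum (I : Type) (s : seq I) (X : I -> Omega -> R) :
  (forall i, intg (X i)) -> intg (fun w => \sum_(i <- s) X i w).
Proof.
move=> iX; elim: s => [|i s IH].
  by under [fun w => _]eq_fun do rewrite big_nil; exact: intg_cst.
by under [fun w => _]eq_fun do rewrite big_cons; exact: intgD.
Qed.

Lemma Ex_sum (I : Type) (s : seq I) (X : I -> Omega -> R) :
  (forall i, intg (X i)) ->
  Ex (fun w => \sum_(i <- s) X i w) = \sum_(i <- s) Ex (X i).
Proof.
move=> iX; elim: s => [|i s IH].
  by under [fun w => _]eq_fun do rewrite big_nil; rewrite Ex_cst big_nil.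
under [fun w => _]eq_fun do rewrite big_cons.
by rewrite ExD ?IH ?big_cons //; exact: intg_sum.
Qed.

Lemma Ex_le X Y : intg X -> intg Y -> (forall w, X w <= Y w) -> Ex X <= Ex Y.
Proof.
move=> iX iY XY; rewrite -lee_fin -!ExE //.
by apply: le_integral => // w _; rewrite lee_fin.
Qed.

Lemma intg_le (X Y : Omega -> R) : measurable_fun setT X -> intg Y ->
  (forall w, `|X w| <= Y w) -> intg X.
Proof.
move=> mX iY XY; apply: (le_integrable measurableT _ _ iY).
  exact/measurable_EFinP.
by move=> w _; rewrite /= lee_fin (le_trans (XY w)) // ler_norm.
Qed.

Lemma Ex_mul_independent (dT : measure_display) (T : measurableType dT)
    (A : Omega -> T) (a : T -> R) (W : Omega -> R) :
  measurable_fun setT A -> measurable_fun setT a ->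
  (forall S B, measurable S -> measurable B ->
    P ((A @^-1` S) `&` (W @^-1` B)) = (P (A @^-1` S) * P (W @^-1` B))%E) ->
  intg W -> intg (fun w => a (A w)) -> intg (fun w => a (A w) * W w) ->
  Ex (fun w => a (A w) * W w) = Ex (fun w => a (A w)) * Ex W.
Proof.
move=> mA ma ind iW ia iaW.
have mW := intg_measurable iW.
pose Wm : {mfun Omega >-> R} := HB.pack W (isMeasurableFun.Build _ _ _ _ W mW).
pose nu : probability R R := distribution P Wm.
have mh : measurable_fun setT (fun z : T * R => (a z.1 * z.2)%:E).
  apply/measurable_EFinP; apply: measurable_funM => //.
  exact: measurableT_comp.
have inu : nu.-integrable setT (EFin : R -> \bar R).
  by apply: integrable_pushforward.
have := integral_independent _ _ _ P _ _ A _ _ W nu mA mW ind _ mh iaW.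
rewrite /= ExE // => h; apply: EFin_inj; rewrite h {h}.
under eq_integral => w _.
  under eq_integral do rewrite EFinM.
  rewrite integralZl //.
  rewrite (_ : \int[nu]_e e%:E = (Ex W)%:E)%E; last first.
    by rewrite integral_distribution //= ExE.
  rewrite -EFinM mulrC.
  over.
rewrite /= ExE; last exact: intgZ.
by rewrite ExZ // mulrC.
Qed.
End RealExpectation.

(** * The uniform distribution on the Stiefel manifold *)

Section Haar.
Variables (R : realType) (dO : measure_display) (Omega : measurableType dO).
Variable (P : probability Omega R).

(** Entry (i, j) of M M^T; for a Stiefel matrix, of the orthogonal projection onto its column
    space. *)
Definition gram p k (M : 'M[R]_(p, k)) (i j : 'I_p) : R := \sum_a M i a * M j a.

(** Haar invariance is stated for events in the sigma-algebra of the entries; events about Gram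
    entries must be brought into it. *)
Lemma mx_events_gram p k (i j : 'I_p) (B : set R) : measurable B ->
  @mx_events R p k [set M | B (gram M i j)].
Proof.
move=> mB.
pose gen : set (set 'M[R]_(p, k)) := [set S | exists (i : 'I_p) (j : 'I_k) (A : set R),
                 measurable A /\ S = [set M : 'M[R]_(p, k) | A (M i j)]].
pose T := g_sigma_algebraType gen.
have mentry (i' : 'I_p) (j' : 'I_k) :
    measurable_fun setT (fun M : T => (M : 'M[R]_(p, k)) i' j').
  move=> _ S mS; rewrite setTI; apply: sub_sigma_algebra.
  by exists i', j', S.
have mgram :
    measurable_fun setT (fun M : T => gram M i j).
  by apply: measurable_sum => a; apply: measurable_funM; exact: mentry.
by have := mgram measurableT B mB; rewrite setTI.
Qed.

Variables (p k : nat) (X : Omega -> 'M[R]_(p, k)).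
Hypothesis HX : uniform_stiefel P X.

Let mX i j : measurable_fun setT (fun w => X w i j).
Proof. by case: HX => h _; exact: h. Qed.

Lemma stiefel_orth w : (X w)^T *m X w = 1%:M.
Proof. by case: HX => _ [h _]; exact: h. Qed.

Lemma measurable_gram i j : measurable_fun setT (fun w => gram (X w) i j).
Proof. by apply: measurable_sum => a; apply: measurable_funM. Qed.

Let entry_le1 w i a : `|X w i a| <= 1.
Proof.
have := stiefel_orth w => /matrixP /(_ a a); rewrite !mxE eqxx => h.
have : X w i a ^+ 2 <= 1.
  rewrite -[X in _ <= X]h (bigD1 i) //= mxE -expr2 lerDl sumr_ge0 // => j _.
  by rewrite mxE -expr2 sqr_ge0.
by rewrite -[X w i a ^+ 2]real_normK ?num_real // expr_le1.
Qed.

Lemma gram_le w i j : `|gram (X w) i j| <= k%:R.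
Proof.
apply: le_trans (ler_norm_sum _ _ _) _.
have -> : k%:R = \sum_(a < k) (1 : R) by rewrite sumr_const card_ord.
apply: ler_sum => a _; rewrite normrM mulr_ile1 //.
Qed.

Lemma intg_gram i j : intg P (fun w => gram (X w) i j).
Proof.
apply: (@intg_le _ _ _ _ _ (fun=> k%:R)).
- exact: measurable_gram.
- exact: intg_cst.
- by move=> w; exact: gram_le.
Qed.

Lemma Ex_gram_invariant (U : 'M[R]_p) i j : U^T *m U = 1%:M ->
  intg P (fun w => gram (U *m X w) i j) ->
  Ex P (fun w => gram (X w) i j) = Ex P (fun w => gram (U *m X w) i j).
Proof.
move=> hU iU.
pose Y1 w := gram (X w) i j.
pose Y2 w := gram (U *m X w) i j.
have m1 : measurable_fun setT Y1 by exact: measurable_gram.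
have m2 : measurable_fun setT Y2 by exact: (intg_measurable iU).
pose Z1 : {mfun Omega >-> R} := HB.pack Y1 (isMeasurableFun.Build _ _ _ _ Y1 m1).
pose Z2 : {mfun Omega >-> R} := HB.pack Y2 (isMeasurableFun.Build _ _ _ _ Y2 m2).
rewrite /Ex; congr fine.
rewrite -[LHS](integral_distribution (X := Z1) (f := EFin)) //; last exact: intg_gram.
rewrite -[RHS](integral_distribution (X := Z2) (f := EFin)) //.
apply: eq_measure_integral => S mS _.
by case: HX => _ [_ h]; have := h U hU _ (mx_events_gram i j mS).
Qed.

(* Invariance under flipping the sign of row [i]. *)
Lemma Ex_gram_offdiag i j : i != j -> Ex P (fun w => gram (X w) i j) = 0.
Proof.
move=> ij.
pose U : 'M[R]_p := diag_mx (\row_a (if a == i then -1 else 1)).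
have UE w b a : (U *m X w) b a = (if b == i then -1 else 1) * X w b a.
  rewrite mul_diag_mx !mxE //.
have hU : U^T *m U = 1%:M.
  rewrite tr_diag_mx mulmx_diag; apply/matrixP => a b; rewrite !mxE.
  by congr (_ *+ _); case: (a == i); rewrite ?mulrNN mulr1.
have gE w : gram (U *m X w) i j = -1 * gram (X w) i j.
  rewrite /gram mulr_sumr; apply: eq_bigr => a _.
  by rewrite !UE eqxx eq_sym (negbTE ij) mul1r mulrA.
have := @Ex_gram_invariant U i j hU.
under [fun w => gram (U *m _) _ _]eq_fun do rewrite gE.
rewrite ExZ; last exact: intg_gram.
move=> /(_ (intgZ _ (intg_gram i j))); lra.
Qed.

(* Invariance under exchanging rows [i] and [j]. *)
Lemma Ex_gram_diag_eq i j :
  Ex P (fun w => gram (X w) i i) = Ex P (fun w => gram (X w) j j).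
Proof.
pose U : 'M[R]_p := tperm_mx i j.
have hU : U^T *m U = 1%:M.
  by rewrite tr_perm_mx -perm_mxM mulVg perm_mx1.
have gE w : gram (U *m X w) i i = gram (X w) j j.
  by apply: eq_bigr => a _; rewrite -xrowE !mxE tpermL.
have := @Ex_gram_invariant U i i hU.
under [fun w => gram (U *m _) _ _]eq_fun do rewrite gE.
by apply; exact: intg_gram.
Qed.

(** The p diagonal entries have the same expectation and add up to the trace of X^T X, which is
    k. *)
Lemma Ex_gram i j :
  Ex P (fun w => gram (X w) i j) = (i == j)%:R * (k%:R / p%:R).
Proof.
case: eqP => [<-|/eqP ij]; last by rewrite mul0r Ex_gram_offdiag.
rewrite mul1r.
have p0 : (p%:R : R) != 0 by rewrite pnatr_eq0 -lt0n (leq_ltn_trans _ (ltn_ord i)).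
apply: (mulfI p0); rewrite mulrCA divff // mulr1.
have trE w : \sum_b gram (X w) b b = k%:R.
  have : \tr ((X w)^T *m X w) = k%:R by rewrite stiefel_orth mxtrace1.
  rewrite mxtrace_mulC => <-; apply: eq_bigr => b _.
  by rewrite mxE; apply: eq_bigr => a _; rewrite mxE.
have : Ex P (fun w => \sum_b gram (X w) b b) = k%:R.
  by under [fun w => _]eq_fun do rewrite trE; exact: Ex_cst.
rewrite Ex_sum; last by move=> b; exact: intg_gram.
rewrite (eq_bigr (fun=> Ex P (fun w => gram (X w) i i))); last first.
  by move=> b _; exact: Ex_gram_diag_eq.
by rewrite sumr_const card_ord mulr_natl.
Qed.
End Haar.

(** * Expected residual of a uniform random projection *)

Section Residual.
Variable R : realType.

Lemma frob2_tr p q (M : 'M[R]_(p, q)) : frob2 M = \tr (M^T *m M).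
Proof.
rewrite /frob2 exchange_big /=; apply: eq_bigr => j _.
by rewrite mxE; apply: eq_bigr => i _; rewrite mxE expr2.
Qed.

Lemma frob2_trmx p q (M : 'M[R]_(p, q)) : frob2 M^T = frob2 M.
Proof.
rewrite /frob2 exchange_big /=; apply: eq_bigr => i _; apply: eq_bigr => j _.
by rewrite mxE.
Qed.

Lemma frob2_ge0 p q (M : 'M[R]_(p, q)) : 0 <= frob2 M.
Proof. by apply: sumr_ge0 => i _; apply: sumr_ge0 => j _; exact: sqr_ge0. Qed.

(** The projected part is written as the pairing of M M^T with X X^T, in which each term is a
    function of M times a function of X: independence can then factor it. *)
Lemma frob2_residual p k q (X : 'M[R]_(p, k)) (M : 'M[R]_(p, q)) :
  X^T *m X = 1%:M ->
  frob2 (M - X *m (X^T *m M)) =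
  frob2 M - \sum_i \sum_j gram M i j * gram X i j.
Proof.
move=> hX.
have -> : \sum_i \sum_j gram M i j * gram X i j = \tr (M^T *m (X *m (X^T *m M))).
  rewrite mxtrace_mulC -!mulmxA mulmxA /mxtrace.
  apply: eq_bigr => i _; rewrite mxE; apply: eq_bigr => j _.
  rewrite mulrC !mxE /gram; congr (_ * _); apply: eq_bigr => a _; rewrite !mxE //.
  by rewrite mulrC.
rewrite !frob2_tr [(_ - _)^T]linearB /= mulmxBl !mulmxBr.
rewrite !trmx_mul trmxK.
have -> : M^T *m X *m X^T *m (X *m (X^T *m M)) = M^T *m (X *m (X^T *m M)).
  by rewrite -!mulmxA (mulmxA X^T X) hX mul1mx.
by rewrite -!mulmxA subrr subr0 linearB.
Qed.

Variables (dO : measure_display) (Omega : measurableType dO).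
Variable (P : probability Omega R).
Variables (p k : nat) (X : Omega -> 'M[R]_(p, k)).
Hypothesis HX : uniform_stiefel P X.
Variables (dT : measure_display) (T : measurableType dT) (A : Omega -> T).
Hypothesis mA : measurable_fun setT A.
Hypothesis indep : forall S B, measurable S -> @mx_events R p k B ->
  (P ((A @^-1` S) `&` (X @^-1` B)) = P (A @^-1` S) * P (X @^-1` B))%E.
Variables (q : nat) (a : T -> 'M[R]_(p, q)).
Hypothesis ma : forall i j, measurable_fun setT (fun t => a t i j).
Hypothesis ia : intg P (fun w => frob2 (a (A w))).

Lemma measurable_frob2 (d : measure_display) (T' : measurableType d) p' q'
    (b : T' -> 'M[R]_(p', q')) :
  (forall i j, measurable_fun setT (fun t => b t i j)) ->
  measurable_fun setT (fun t => frob2 (b t)).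
Proof.
move=> mb; apply: measurable_sum => i; apply: measurable_sum => j.
exact: measurable_funX.
Qed.

Let m_gram i j : measurable_fun setT (fun t => gram (a t) i j).
Proof. by apply: measurable_sum => b; apply: measurable_funM. Qed.

(** Each of the two squared entries is bounded by the whole column sum, which also covers i = j;
    then 2 |u v| <= u^2 + v^2. *)
Let gram_le_frob2 (M : 'M[R]_(p, q)) i j : `|gram M i j| <= frob2 M.
Proof.
apply: le_trans (ler_norm_sum _ _ _) _.
rewrite /frob2 exchange_big /=; apply: ler_sum => b _.
have h i' : M i' b ^+ 2 <= \sum_i0 M i0 b ^+ 2.
  by rewrite (bigD1 i') //= lerDl sumr_ge0 // => c _; exact: sqr_ge0.
rewrite normrM.
have := h i; have := h j; rewrite -[M i b ^+ 2]real_normK ?num_real //.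
rewrite -[M j b ^+ 2]real_normK ?num_real //.
have := sqr_ge0 (`|M i b| - `|M j b|).
by move: `|M i b| `|M j b| (\sum_i0 _) => u v S *; nra.
Qed.

Let ia_gram i j : intg P (fun w => gram (a (A w)) i j).
Proof.
apply: (intg_le _ ia) => [|w]; last exact: gram_le_frob2.
by apply: (measurableT_comp (m_gram i j)).
Qed.

Let ia_gram2 i j : intg P (fun w => gram (a (A w)) i j * gram (X w) i j).
Proof.
apply: (intg_le _ (intgZ k%:R ia)).
  apply: measurable_funM; last exact: (measurable_gram HX).
  by apply: (measurableT_comp (m_gram i j)).
move=> w; rewrite normrM mulrC; apply: ler_pM => //.
exact: (gram_le HX).
Qed.

Let resE w : frob2 (a (A w) - X w *m ((X w)^T *m a (A w))) =
  frob2 (a (A w)) +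
  (-1) * \sum_i \sum_j gram (a (A w)) i j * gram (X w) i j.
Proof. by rewrite frob2_residual ?(stiefel_orth HX) // mulN1r. Qed.

Lemma intg_residual :
  intg P (fun w => frob2 (a (A w) - X w *m ((X w)^T *m a (A w)))).
Proof.
under [fun w => _]eq_fun do rewrite resE.
apply: intgD => //; apply: intgZ; apply: intg_sum => i; exact: intg_sum.
Qed.

(** By independence the products of Gram entries factor; off-diagonal ones vanish, and the diagonal
    gives k / p times the trace of M M^T, which is |M|^2. *)
Lemma Ex_residual :
  Ex P (fun w => frob2 (a (A w) - X w *m ((X w)^T *m a (A w)))) =
  (1 - k%:R / p%:R) * Ex P (fun w => frob2 (a (A w))).
Proof.
under [fun w => frob2 (_ - _)]eq_fun do rewrite resE.
have i2 i : intg P (fun w => \sum_j gram (a (A w)) i j * gram (X w) i j).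
  exact: intg_sum.
have i3 : intg P (fun w => \sum_i \sum_j gram (a (A w)) i j * gram (X w) i j).
  exact: intg_sum.
rewrite ExD ?ExZ //; last exact: (intgZ (-1) i3).
rewrite mulrBl mul1r mulN1r; congr (_ - _).
rewrite Ex_sum // [in RHS]/frob2.
have iE i : intg P (fun w => gram (a (A w)) i i) by [].
transitivity (\sum_i k%:R / p%:R * Ex P (fun w => gram (a (A w)) i i)).
  apply: eq_bigr => i _; rewrite Ex_sum // (bigD1 i) //= big1 ?addr0.
    rewrite (Ex_mul_independent mA (m_gram i i) _ (intg_gram HX i i)) //.
      by rewrite (Ex_gram HX) eqxx mul1r mulrC.
    by move=> S B mS mB; exact: (indep mS (mx_events_gram i i mB)).
  move=> j ji; rewrite (Ex_mul_independent mA (m_gram i j) _ (intg_gram HX i j)) //.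
    by rewrite (Ex_gram HX) eq_sym (negbTE ji) mul0r mulr0.
  by move=> S B mS mB; exact: (indep mS (mx_events_gram i j mB)).
by rewrite -mulr_sumr -Ex_sum.
Qed.
End Residual.

(** * The GoLore iteration *)

Section Layer.
Variables (R : realType) (p q k : nat) (beta eta : R).
Implicit Types (P : 'M[R]_(p, k)) (Q : 'M[R]_(q, k)) (A B : 'M[R]_(p, q)).

Definition lmom P Q (s : lstate R p q k) : 'M[R]_(p, q) :=
  if (p <= q)%N then P *m lML s else lMR s *m Q^T.

Definition lproj P Q A : 'M[R]_(p, q) :=
  if (p <= q)%N then P *m (P^T *m A) else (A *m Q) *m Q^T.

(** The factor P^T P' in the momentum update is a change of coordinates: after lifting, it amounts
    to the new projection applied to the old lifted momentum. *)
Lemma lmom_lstep P P' Q Q' G s :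
  lmom P Q (lstep beta eta P P' Q Q' G s) =
  lproj P Q ((1 - beta) *: lmom P' Q' s + beta *: G).
Proof.
rewrite /lmom /lstep /lproj; case: (p <= q)%N => /=.
  by rewrite !mulmxDr -!scalemxAr !mulmxA.
by rewrite !mulmxDl -!scalemxAl.
Qed.

Lemma lX_lstep P P' Q Q' G s :
  lX (lstep beta eta P P' Q Q' G s) =
  lX s - eta *: lmom P Q (lstep beta eta P P' Q Q' G s).
Proof. by rewrite /lmom /lstep; case: (p <= q)%N. Qed.

Lemma lprojD P Q A B : lproj P Q (A + B) = lproj P Q A + lproj P Q B.
Proof. by rewrite /lproj; case: (p <= q)%N; rewrite ?mulmxDr ?mulmxDl. Qed.

Lemma lprojZ P Q c A : lproj P Q (c *: A) = c *: lproj P Q A.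
Proof. by rewrite /lproj; case: (p <= q)%N; rewrite -?scalemxAr -?scalemxAl. Qed.

Lemma lproj_idem P Q A : P^T *m P = 1%:M -> Q^T *m Q = 1%:M ->
  lproj P Q (lproj P Q A) = lproj P Q A.
Proof.
move=> hP hQ; rewrite /lproj; case: (p <= q)%N.
  by rewrite (mulmxA P^T P) hP mul1mx.
by rewrite -(mulmxA _ Q^T Q) hQ mulmx1.
Qed.

Lemma mxdot_tr A B : \sum_i \sum_j A i j * B i j = \tr (A^T *m B).
Proof.
rewrite exchange_big /=; apply: eq_bigr => j _.
by rewrite mxE; apply: eq_bigr => i _; rewrite mxE.
Qed.

Lemma lproj_sym P Q A B :
  \sum_i \sum_j lproj P Q A i j * B i j = \sum_i \sum_j A i j * lproj P Q B i j.
Proof.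
rewrite !mxdot_tr /lproj; case: (p <= q)%N; rewrite !trmx_mul !trmxK !mulmxA //.
by rewrite [in RHS]mxtrace_mulC !mulmxA [in RHS]mxtrace_mulC !mulmxA.
Qed.

Lemma measurable_mulmx (d : measure_display) (T : measurableType d) a b c
    (A : T -> 'M[R]_(a, b)) (B : T -> 'M[R]_(b, c)) :
  (forall i j, measurable_fun setT (fun w => A w i j)) ->
  (forall i j, measurable_fun setT (fun w => B w i j)) ->
  forall i j, measurable_fun setT (fun w => (A w *m B w) i j).
Proof.
move=> mA mB i j; under eq_fun do rewrite mxE.
by apply: measurable_sum => l; apply: measurable_funM.
Qed.

Lemma measurable_lproj (d : measure_display) (T : measurableType d)
    (P : T -> 'M[R]_(p, k)) (Q : T -> 'M[R]_(q, k)) (A : T -> 'M[R]_(p, q)) :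
  (forall i j, measurable_fun setT (fun w => P w i j)) ->
  (forall i j, measurable_fun setT (fun w => Q w i j)) ->
  (forall i j, measurable_fun setT (fun w => A w i j)) ->
  forall i j, measurable_fun setT (fun w => lproj (P w) (Q w) (A w) i j).
Proof.
move=> mP mQ mA i j.
have tr_meas a b (B : T -> 'M[R]_(a, b)) :
  (forall i j, measurable_fun setT (fun w => B w i j)) ->
  forall i j, measurable_fun setT (fun w => (B w)^T i j).
  by move=> mB i' j'; under eq_fun do rewrite mxE; exact: mB.
rewrite /lproj; case: (p <= q)%N.
  by do 2 apply: measurable_mulmx => //; exact: tr_meas.
by apply: measurable_mulmx; [exact: measurable_mulmx|exact: tr_meas].
Qed.
End Layer.

Section Iteration.
Variables (R : realType) (NL : nat) (m n r : 'I_NL -> nat) (Xi : Type).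
Variables (beta eta : R) (tau : nat).
Variable gF : @param R NL m n -> Xi -> @param R NL m n.
Variable x0 : @param R NL m n.
Variable xis : nat -> Xi.
Variable Pd : nat -> forall l : 'I_NL, 'M[R]_(m l, r l).
Variable Qd : nat -> forall l : 'I_NL, 'M[R]_(n l, r l).

Definition golore_proj (k : nat) (y : @param R NL m n) : @param R NL m n :=
  fun l => lproj (Pd k l) (Qd k l) (y l).

(* As in [golore_state], index [t] carries the momentum M^(t-1). *)
Definition golore_mom (t : nat) : @param R NL m n := fun l =>
  lmom (Pt tau Pd t.-1 l) (Qt tau Qd t.-1 l)
       (golore_state beta eta tau gF x0 xis Pd Qd t l).

Let x := golore_x beta eta tau gF x0 xis Pd Qd.

Lemma golore_mom0 l : golore_mom 0 l = 0.
Proof. by rewrite /golore_mom /lmom /=; case: ifP; rewrite ?mulmx0 ?mul0mx. Qed.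

Lemma golore_momS t l : golore_mom t.+1 l =
  golore_proj (t %/ tau)
    (padd (pscale (1 - beta) (golore_mom t)) (pscale beta (gF (x t) (xis t)))) l.
Proof. exact: lmom_lstep. Qed.

Lemma golore_xS t l : x t.+1 l = x t l - eta *: golore_mom t.+1 l.
Proof. exact: lX_lstep. Qed.

Definition vproj (k : nat) (v : pvec R m n) : pvec R m n :=
  flat (golore_proj k (unflat v)).

Lemma unflat_add (v w : pvec R m n) : unflat (v + w) = padd (unflat v) (unflat w).
Proof. by rewrite -[RHS]flatK flat_add !unflatK. Qed.

Lemma unflat_scale c (v : pvec R m n) : unflat (c *: v) = pscale c (unflat v).
Proof. by rewrite -[RHS]flatK flat_scale !unflatK. Qed.

Lemma vproj_add k v w : vproj k (v + w) = vproj k v + vproj k w.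
Proof.
rewrite /vproj -flat_add unflat_add; congr flat.
by apply: functional_extensionality_dep => l; apply: lprojD.
Qed.

Lemma vproj_scale k c v : vproj k (c *: v) = c *: vproj k v.
Proof.
rewrite /vproj -flat_scale unflat_scale; congr flat.
by apply: functional_extensionality_dep => l; apply: lprojZ.
Qed.

Lemma vproj_selfadjoint k v w : vdot (vproj k v) w = vdot v (vproj k w).
Proof.
rewrite -[w in LHS]unflatK -[v in RHS]unflatK -!pinnerE.
by apply: eq_bigr => l _; apply: lproj_sym.
Qed.

Lemma vproj_idempotent k v :
  (forall l, (Pd k l)^T *m Pd k l = 1%:M) ->
  (forall l, (Qd k l)^T *m Qd k l = 1%:M) -> vproj k (vproj k v) = vproj k v.
Proof.
move=> hP hQ; rewrite /vproj flatK; congr flat.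
by apply: functional_extensionality_dep => l; apply: lproj_idem.
Qed.
End Iteration.

Section IterationMeasurable.
Variables (R : realType) (NL : nat) (m n r : 'I_NL -> nat).
Variables (dX : measure_display) (Xi : measurableType dX).
Variables (beta eta : R) (tau : nat).
Variable gF : @param R NL m n -> Xi -> @param R NL m n.
Variable x0 : @param R NL m n.
Variables (dT : measure_display) (T : measurableType dT).
Hypothesis gF_meas : forall (Y : T -> @param R NL m n) (Z : T -> Xi),
  (forall l i j, measurable_fun setT (fun w => Y w l i j)) ->
  measurable_fun setT Z ->
  forall l i j, measurable_fun setT (fun w => gF (Y w) (Z w) l i j).
Variable xi : nat -> T -> Xi.
Variable Pd : nat -> forall l : 'I_NL, T -> 'M[R]_(m l, r l).
Variable Qd : nat -> forall l : 'I_NL, T -> 'M[R]_(n l, r l).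

Let x w := golore_x beta eta tau gF x0 (fun t => xi t w)
  (fun k l => Pd k l w) (fun k l => Qd k l w).
Let mom w := golore_mom beta eta tau gF x0 (fun t => xi t w)
  (fun k l => Pd k l w) (fun k l => Qd k l w).

(** Only draws made before time [t] are assumed measurable: with [T] carrying the sigma-algebra of
    all draws but one, this expresses that the iterate ignores a draw not yet made. *)
Lemma measurable_iterates t :
  (forall s, (s < t)%N -> measurable_fun setT (xi s)) ->
  (forall s, (s < t)%N -> forall l i j,
     measurable_fun setT (fun w => Pd (s %/ tau)%N l w i j)) ->
  (forall s, (s < t)%N -> forall l i j,
     measurable_fun setT (fun w => Qd (s %/ tau)%N l w i j)) ->
  (forall l i j, measurable_fun setT (fun w => x w t l i j)) /\
  (forall l i j, measurable_fun setT (fun w => mom w t l i j)).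
Proof.
elim: t => [|t IH] mxi mP mQ.
  split=> l i j; first exact: measurable_cst.
  by under eq_fun do rewrite /mom golore_mom0; exact: measurable_cst.
have [||| mx mm] := IH; try by move=> s st; auto.
have mm' : forall l i j, measurable_fun setT (fun w => mom w t.+1 l i j).
  move=> l i j; under eq_fun do rewrite /mom golore_momS.
  apply: measurable_lproj; [exact: mP|exact: mQ|] => i' j'.
  under eq_fun do rewrite !mxE.
  apply: measurable_funD; apply: measurable_funM => //.
  by apply: gF_meas => //; exact: mxi.
split => // l i j.
under eq_fun do rewrite /x golore_xS !mxE.
apply: measurable_funB; first exact: mx.
by apply: measurable_funM => //; exact: mm'.
Qed.
End IterationMeasurable.

(** * Square integrability and the gradient noise *)

Section SquareIntegrable.
Variables (R : realType) (NL : nat) (m n : 'I_NL -> nat).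
Notation vec := (pvec R m n).

Lemma measurable_vdot (d : measure_display) (T : measurableType d) (Y Z : T -> vec) :
  (forall p, measurable_fun setT (fun w => Y w p)) ->
  (forall p, measurable_fun setT (fun w => Z w p)) ->
  measurable_fun setT (fun w => vdot (Y w) (Z w)).
Proof.
by move=> mY mZ; apply: measurable_sum => p; apply: measurable_funM.
Qed.

Lemma vdot_norm_le (v w : vec) : `|vdot v w| <= vdot v v + vdot w w.
Proof.
apply: le_trans (ler_norm_sum _ _ _) _; rewrite -big_split /=.
apply: ler_sum => p _; rewrite normrM -!expr2.
rewrite -[v p ^+ 2]real_normK ?num_real // -[w p ^+ 2]real_normK ?num_real //.
by have := sqr_ge0 (`|v p| - `|w p|); have := sqr_ge0 (`|v p| + `|w p|); lra.
Qed.

Lemma vdotDD_le (v w : vec) :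
  vdot (v + w) (v + w) <= 2 * vdot v v + 2 * vdot w w.
Proof.
rewrite !mulr_sumr -big_split /=; apply: ler_sum => p _; rewrite !ffunE.
have h (a b : R) : (a + b) * (a + b) <= 2 * (a * a) + 2 * (b * b).
  by have := sqr_ge0 (a - b); lra.
exact: h.
Qed.

Variables (dO : measure_display) (Omega : measurableType dO).
Variable (P : probability Omega R).

Definition sqint (Y : Omega -> vec) : Prop :=
  (forall p, measurable_fun setT (fun w => Y w p)) /\
  intg P (fun w => vdot (Y w) (Y w)).

Lemma sqint_le (Y : Omega -> vec) (Z : Omega -> R) :
  (forall p, measurable_fun setT (fun w => Y w p)) -> intg P Z ->
  (forall w, vdot (Y w) (Y w) <= Z w) -> sqint Y.
Proof.
move=> mY iZ YZ; split => //; apply: (intg_le _ iZ); first exact: measurable_vdot.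
by move=> w; rewrite ger0_norm //; exact: vdot_ge0.
Qed.

Lemma intg_vdot Y Z : sqint Y -> sqint Z -> intg P (fun w => vdot (Y w) (Z w)).
Proof.
move=> [mY iY] [mZ iZ]; apply: (intg_le _ (intgD iY iZ)).
  exact: measurable_vdot.
by move=> w; exact: vdot_norm_le.
Qed.

Lemma sqintD Y Z : sqint Y -> sqint Z -> sqint (fun w => Y w + Z w).
Proof.
move=> [mY iY] [mZ iZ].
apply: (sqint_le _ (intgD (intgZ 2 iY) (intgZ 2 iZ))); last first.
  by move=> w; exact: vdotDD_le.
by move=> p; under eq_fun do rewrite ffunE; exact: measurable_funD.
Qed.

Lemma sqintZ c Y : sqint Y -> sqint (fun w => c *: Y w).
Proof.
move=> [mY iY]; apply: (sqint_le _ (intgZ (c ^+ 2) iY)) => [p|w].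
  by under eq_fun do rewrite ffunE; exact: measurable_funM.
by rewrite vdotZl vdotC vdotZl mulrA expr2.
Qed.
End SquareIntegrable.

(** * Mean and variance of the gradient noise given the past *)

Section Noise.
Variables (R : realType) (NL : nat) (m n : 'I_NL -> nat).
Variables (dO : measure_display) (Omega : measurableType dO).
Variable (P : probability Omega R).
Variables (dX : measure_display) (Xi : measurableType dX) (D : probability Xi R).
Variables (dT : measure_display) (T : measurableType dT) (A : Omega -> T) (W : Omega -> Xi).
Variables (gF : @param R NL m n -> Xi -> @param R NL m n).
Variables (gf : @param R NL m n -> @param R NL m n) (sig : 'I_NL -> R).
Variable x : T -> @param R NL m n.
Hypotheses (mA : measurable_fun setT A) (mW : measurable_fun setT W).
Hypothesis indep : forall S B, measurable S -> measurable B ->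
  (P ((A @^-1` S) `&` (W @^-1` B)) = P (A @^-1` S) * D B)%E.
Hypothesis gF_meas : forall l i j,
  measurable_fun setT (fun z : T * Xi => gF (x z.1) z.2 l i j).
Hypothesis gf_meas : forall l i j, measurable_fun setT (fun t => gf (x t) l i j).
Hypothesis gF_int : forall y l i j, D.-integrable setT (fun s => (gF y s l i j)%:E).
Hypothesis gF_mean : forall y l i j,
  (\int[D]_s (gF y s l i j)%:E = (gf y l i j)%:E)%E.
Hypothesis gF_var : forall y l,
  (\int[D]_s (frob2 (gF y s l - gf y l))%:E <= (sig l ^+ 2)%:E)%E.

Definition noise (w : Omega) : pvec R m n :=
  flat (psub (gF (x (A w)) (W w)) (gf (x (A w)))).

Let mAW : measurable_fun setT (fun w => (A w, W w)).
Proof. exact: measurable_fun_pair. Qed.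

Let m_diff l i j :
  measurable_fun setT (fun z : T * Xi => (gF (x z.1) z.2 l - gf (x z.1) l) i j).
Proof.
under eq_fun do rewrite !mxE; apply: measurable_funB => //.
by apply: (@measurableT_comp _ _ _ _ _ _ (fun t => gf (x t) l i j) setT (@fst T Xi)).
Qed.

Lemma measurable_noise p : measurable_fun setT (fun w => noise w p).
Proof.
have := measurableT_comp (@m_diff (tag p) (tagged p).1 (tagged p).2) mAW.
by apply: eq_measurable_fun => w _; rewrite [noise w p]ffunE.
Qed.

Let layer_noise l w := frob2 (gF (x (A w)) (W w) l - gf (x (A w)) l).

Let m_layer l : measurable_fun setT (layer_noise l).
Proof.
have := measurableT_comp (measurable_frob2 (@m_diff l)) mAW.
by apply: eq_measurable_fun.
Qed.

(** Tonelli asks for no integrability; the finite bound obtained here then yields it. *)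
Let layer_bound l : (\int[P]_w (layer_noise l w)%:E <= (sig l ^+ 2)%:E)%E.
Proof.
have := ge0_integral_independent _ _ _ P _ _ A _ _ W D mA mW indep
  (fun z : T * Xi => (frob2 (gF (x z.1) z.2 l - gf (x z.1) l))%:E).
move=> ->; last 2 first.
- by apply/measurable_EFinP; exact: measurable_frob2 (@m_diff l).
- by move=> z; rewrite lee_fin frob2_ge0.
apply: (@le_trans _ _ (\int[P]_w (sig l ^+ 2)%:E)%E); last first.
  by rewrite integral_cst //= probability_setT mule1.
apply: ge0_le_integral => //.
- by move=> w _; apply: integral_ge0 => s _; rewrite lee_fin frob2_ge0.
- have h : measurable_fun setT
      (fun t => \int[D]_s (frob2 (gF (x t) s l - gf (x t) l))%:E)%E.
    apply: (@measurable_fun_fubini_tonelli_F _ _ _ _ _ D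
      (fun z : T * Xi => (frob2 (gF (x z.1) z.2 l - gf (x z.1) l))%:E)).
      by apply/measurable_EFinP; exact: measurable_frob2 (@m_diff l).
    by move=> z; rewrite lee_fin frob2_ge0.
  by have := measurableT_comp h mA; apply: eq_measurable_fun.
by move=> w _ /=; exact: gF_var.
Qed.

Let intg_layer l : intg P (layer_noise l).
Proof.
apply/integrableP; split; first exact/measurable_EFinP/m_layer.
under eq_integral do rewrite gee0_abs ?lee_fin ?frob2_ge0 //.
by rewrite (le_lt_trans (layer_bound l)) ?ltry.
Qed.

Let noiseE w : vdot (noise w) (noise w) = \sum_l layer_noise l w.
Proof. by rewrite -pnorm2E. Qed.

Lemma sqint_noise : sqint P noise.
Proof.
split; first exact: measurable_noise.
by under [fun w => _]eq_fun do rewrite noiseE; exact: intg_sum.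
Qed.

Lemma Ex_noise_le : Ex P (fun w => vdot (noise w) (noise w)) <= \sum_l sig l ^+ 2.
Proof.
under [fun w => _]eq_fun do rewrite noiseE.
rewrite Ex_sum //; apply: ler_sum => l _.
by rewrite -lee_fin -ExE //; exact: layer_bound.
Qed.

(** The fresh draw is integrated first, one coordinate at a time: for a frozen past the noise has
    mean zero. Square integrability of both factors makes Fubini applicable. *)
Lemma Ex_vdot_noise (u : T -> pvec R m n) :
  (forall p, measurable_fun setT (fun t => u t p)) ->
  sqint P (fun w => u (A w)) ->
  Ex P (fun w => vdot (u (A w)) (noise w)) = 0.
Proof.
move=> mu squ.
have iup p : intg P (fun w => u (A w) p * noise w p).
  apply: (intg_le _ (intgD squ.2 sqint_noise.2)).
    by apply: measurable_funM; [case: squ|exact: measurable_noise].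
  move=> w; apply: (@le_trans _ _ (`|u (A w) p| ^+ 2 + `|noise w p| ^+ 2)).
    rewrite normrM; have := sqr_ge0 (`|u (A w) p| - `|noise w p|).
    by have := sqr_ge0 (`|u (A w) p| + `|noise w p|); lra.
  have h (v : pvec R m n) : `|v p| ^+ 2 <= vdot v v.
    rewrite real_normK ?num_real // /vdot (bigD1 p) //= -expr2 lerDl sumr_ge0 //.
    by move=> q _; rewrite -expr2 sqr_ge0.
  by apply: lerD; exact: h.
rewrite /vdot Ex_sum // big1 // => p _.
case: p iup => l [i j] /(_ (existT _ l (i, j))) iup.
set p := existT _ _ _ in iup *.
have hE w : u (A w) p * noise w p =
    u (A w) p * (gF (x (A w)) (W w) l - gf (x (A w)) l) i j.
  by rewrite [noise w p]ffunE.
have iup' : intg P (fun w => u (A w) p * (gF (x (A w)) (W w) l - gf (x (A w)) l) i j).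
  by move: iup; under [fun w => _]eq_fun do rewrite hE.
under [fun w => _]eq_fun do rewrite hE.
rewrite /Ex.
have := integral_independent _ _ _ P _ _ A _ _ W D mA mW indep
  (fun z : T * Xi => (u z.1 p * (gF (x z.1) z.2 l - gf (x z.1) l) i j)%:E).
move=> -> //; last first.
  apply/measurable_EFinP; apply: measurable_funM => //.
  by apply: (@measurableT_comp _ _ _ _ _ _ (fun t => u t p) setT (@fst T Xi)).
rewrite (_ : (fun w => _) = fun=> 0%E); first by rewrite integral0.
apply/funext => w /=.
under eq_integral do rewrite EFinM !mxE EFinB.
have iB : D.-integrable setT
    (fun s => (gF (x (A w)) s l i j)%:E - (gf (x (A w)) l i j)%:E)%E.
  by apply: integrableB => //; exact: finite_measure_integrable_cst.
rewrite integralZl // integralB //; last exact: finite_measure_integrable_cst.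
by rewrite gF_mean integral_cst //= probability_setT mule1 subee ?mule0.
Qed.
End Noise.

(** * Expectations along the iteration *)

Section GeneratedEvents.
Variables (R : realType) (dO : measure_display) (Omega : measurableType dO).

Lemma sigma_rv_measurable dX (Xi : measurableType dX) (Y : Omega -> Xi) :
  measurable_fun setT Y -> sigma_rv Y `<=` measurable.
Proof. by move=> mY _ [B mB <-]; rewrite -[X in measurable X]setTI; exact: mY. Qed.

Lemma sigma_rvI dX (Xi : measurableType dX) (Y : Omega -> Xi) :
  setI_closed (sigma_rv Y).
Proof.
move=> _ _ [B mB <-] [C mC <-]; exists (B `&` C); last by rewrite preimage_setI.
exact: measurableI.
Qed.

Lemma sigma_mx_measurable p q (X : Omega -> 'M[R]_(p, q)) :
  measurable_mx X -> sigma_mx X `<=` measurable.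
Proof.
move=> mX _ [B mB <-].
pose gen : set (set 'M[R]_(p, q)) := [set S | exists (i : 'I_p) (j : 'I_q) (A : set R),
                 measurable A /\ S = [set M : 'M[R]_(p, q) | A (M i j)]].
have mX' : measurable_fun setT (X : Omega -> g_sigma_algebraType gen).
  apply: (@measurability _ _ Omega (g_sigma_algebraType gen) setT X gen) => //
    _ [_ [i [j [A [mA ->]]]] <-].
  exact: mX.
by have := mX' measurableT B mB; rewrite setTI.
Qed.

Lemma sigma_mxI p q (X : Omega -> 'M[R]_(p, q)) : setI_closed (sigma_mx X).
Proof.
move=> _ _ [B mB <-] [C mC <-]; exists (B `&` C); last by rewrite preimage_setI.
pose gen : set (set 'M[R]_(p, q)) := [set S | exists (i : 'I_p) (j : 'I_q) (A : set R),
                 measurable A /\ S = [set M : 'M[R]_(p, q) | A (M i j)]].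
exact: (@measurableI _ (g_sigma_algebraType gen)).
Qed.

Lemma sigma_mx_entry p q (X : Omega -> 'M[R]_(p, q)) i j (A : set R) :
  measurable A -> sigma_mx X [set w | A (X w i j)].
Proof.
move=> mA; exists [set M : 'M[R]_(p, q) | A (M i j)] => //.
by apply: sub_sigma_algebra; exists i, j, A.
Qed.
End GeneratedEvents.

(** * Moments along the iteration and the expected bound *)

Section Convergence.
Variables (R : realType) (NL : nat) (m n r : 'I_NL -> nat).
Variables (dX : measure_display) (Xi : measurableType dX) (D : probability Xi R).
Variables (F : @param R NL m n -> Xi -> R) (gF : @param R NL m n -> Xi -> @param R NL m n).
Variables (f : @param R NL m n -> R) (gf : @param R NL m n -> @param R NL m n).
Variables (L : R) (sig : 'I_NL -> R).
Variables (dO : measure_display) (Omega : measurableType dO) (P : probability Omega R).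
Variable xi : nat -> Omega -> Xi.
Variable Pdraw : nat -> forall l : 'I_NL, Omega -> 'M[R]_(m l, r l).
Variable Qdraw : nat -> forall l : 'I_NL, Omega -> 'M[R]_(n l, r l).
Variables (x0 : @param R NL m n) (beta1 eta : R) (tau : nat).
Hypothesis F_int : forall x, D.-integrable setT (fun s => (F x s)%:E).
Hypothesis gF_grad : forall s, is_gradient (fun x => F x s) (fun x => gF x s).
Hypothesis gf_grad : is_gradient f gf.
Hypothesis f_lower : exists c : R, forall x, c <= f x.
Hypothesis gf_lip : lipschitz2 L gf.
Hypothesis gF_int : forall x l i j, D.-integrable setT (fun s => (gF x s l i j)%:E).
Hypothesis gF_mean : forall x l i j,
  (\int[D]_s (gF x s l i j)%:E = (gf x l i j)%:E)%E.
Hypothesis gF_var : forall x l,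
  (\int[D]_s (frob2 (gF x s l - gf x l))%:E <= (sig l ^+ 2)%:E)%E.
Hypothesis xi_meas : forall t, measurable_fun setT (xi t).
Hypothesis xi_law : forall t A, measurable A -> P (xi t @^-1` A) = D A.
Hypothesis P_unif : forall k l, uniform_stiefel P (Pdraw k l).
Hypothesis Q_unif : forall k l, uniform_stiefel P (Qdraw k l).
Hypothesis indep : mutually_independent P (golore_sigmas xi Pdraw Qdraw).
Hypothesis L0 : 0 < L.
Hypothesis tau0 : (0 < tau)%N.

Let Fam := golore_sigmas xi Pdraw Qdraw.
Let Idx := ((nat + (nat * 'I_NL)) + (nat * 'I_NL))%type.

Let Fam_meas (i : Idx) : Fam i `<=` measurable.
Proof.
case: i => [[t|[k l]]|[k l]] /=.
- exact: sigma_rv_measurable.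
- by apply: sigma_mx_measurable; case: (P_unif k l).
- by apply: sigma_mx_measurable; case: (Q_unif k l).
Qed.

Let FamI (i : Idx) : setI_closed (Fam i).
Proof.
by case: i => [[t|[k l]]|[k l]] /=; [exact: sigma_rvI|exact: sigma_mxI|exact: sigma_mxI].
Qed.

(* [Omega] with the information carried by all draws but [i0]. *)
Let Others (i0 : Idx) := g_sigma_algebraType (other_events _ _ _ Fam i0).

Let id_Others (i0 : Idx) : measurable_fun setT (id : Omega -> Others i0).
Proof.
apply: (@measurability _ _ Omega (Others i0) setT id (other_events _ _ _ Fam i0)) => //
  _ [S hS <-].
by rewrite setTI; exact: (other_events_measurable _ _ _ _ Fam_meas _ _ hS).
Qed.

Let indep_Others (i0 : Idx) (S : set (Others i0)) (B : set Omega) :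
  measurable S -> Fam i0 B -> (P (S `&` B) = P S * P B)%E.
Proof. exact: (independent_of_others _ _ _ _ _ _ Fam_meas FamI indep). Qed.

Let xi_Others (i0 : Idx) t : inl (inl t) != i0 ->
  measurable_fun setT (xi t : Others i0 -> Xi).
Proof.
move=> ti _ B mB; rewrite setTI; apply: sub_sigma_algebra.
by apply: (sub_other_events _ _ _ Fam _ _ ti); exists B.
Qed.

Let P_Others (i0 : Idx) k l i j : inl (inr (k, l)) != i0 ->
  measurable_fun setT (fun w : Others i0 => Pdraw k l w i j).
Proof.
move=> ti _ B mB; rewrite setTI; apply: sub_sigma_algebra.
by apply: (sub_other_events _ _ _ Fam _ _ ti); exact: sigma_mx_entry.
Qed.

Let Q_Others (i0 : Idx) k l i j : inr (k, l) != i0 ->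
  measurable_fun setT (fun w : Others i0 => Qdraw k l w i j).
Proof.
move=> ti _ B mB; rewrite setTI; apply: sub_sigma_algebra.
by apply: (sub_other_events _ _ _ Fam _ _ ti); exact: sigma_mx_entry.
Qed.

Let F_meas x : measurable_fun setT (F x).
Proof. by have /integrableP[/measurable_EFinP] := F_int x. Qed.

(** The source space is arbitrary because three are needed: [Omega], [Omega] with a smaller
    sigma-algebra, and the product of the latter with [Xi]. *)
Let gF_meas (d : measure_display) (T : measurableType d)
    (Y : T -> @param R NL m n) (Z : T -> Xi) :
  (forall l i j, measurable_fun setT (fun w => Y w l i j)) ->
  measurable_fun setT Z ->
  forall l i j, measurable_fun setT (fun w => gF (Y w) (Z w) l i j).
Proof. by move=> mY mZ l i j; exact: (measurable_gradient gF_grad F_meas). Qed.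

Let gf_meas (d : measure_display) (T : measurableType d) (Y : T -> @param R NL m n) :
  (forall l i j, measurable_fun setT (fun w => Y w l i j)) ->
  forall l i j, measurable_fun setT (fun w => gf (Y w) l i j).
Proof.
move=> mY l i j.
(* [f] is viewed as an integrand constant in the sample, evaluated at an arbitrary [point]. *)
apply: (@measurable_gradient _ _ _ _ _ Xi (fun x _ => f x) (fun x _ => gf x)
          _ _ _ T Y (fun=> point)) => //.
Qed.

Let xw (w : Omega) : nat -> @param R NL m n :=
  golore_x beta1 eta tau gF x0 (fun t => xi t w)
    (fun k l => Pdraw k l w) (fun k l => Qdraw k l w).
Let momw (w : Omega) : nat -> @param R NL m n :=
  golore_mom beta1 eta tau gF x0 (fun t => xi t w)
    (fun k l => Pdraw k l w) (fun k l => Qdraw k l w).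
Let pr (k : nat) (w : Omega) : pvec R m n -> pvec R m n :=
  vproj (fun k l => Pdraw k l w) (fun k l => Qdraw k l w) k.
Let X t w : pvec R m n := flat (xw w t).
Let M t w : pvec R m n := flat (momw w t).
Let G t w : pvec R m n := flat (gf (xw w t)).
Let Nz t w : pvec R m n := flat (psub (gF (xw w t) (xi t w)) (gf (xw w t))).
Let U t w : pvec R m n := pr (t %/ tau)%N w (M t w - G t w).

(** [phi] will be the identity on points; it only changes the sigma-algebra on [Omega]. *)
Let meas_XM (d : measure_display) (T : measurableType d) (phi : T -> Omega) t :
  (forall s, (s < t)%N -> measurable_fun setT (xi s \o phi)) ->
  (forall s, (s < t)%N -> forall l i j,
     measurable_fun setT (fun w => Pdraw (s %/ tau)%N l (phi w) i j)) ->
  (forall s, (s < t)%N -> forall l i j,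
     measurable_fun setT (fun w => Qdraw (s %/ tau)%N l (phi w) i j)) ->
  (forall l i j, measurable_fun setT (fun w => xw (phi w) t l i j)) /\
  (forall l i j, measurable_fun setT (fun w => momw (phi w) t l i j)).
Proof.
move=> h1 h2 h3.
exact: (@measurable_iterates R NL m n r dX Xi beta1 eta tau gF x0 d T
  (@gF_meas d T) (fun s w => xi s (phi w)) (fun k l w => Pdraw k l (phi w))
  (fun k l w => Qdraw k l (phi w)) t).
Qed.

Let meas_XM_xi t :
  (forall l i j, measurable_fun setT (fun w : Others (inl (inl t)) => xw w t l i j)) /\
  (forall l i j, measurable_fun setT (fun w : Others (inl (inl t)) => momw w t l i j)).
Proof.
apply: (@meas_XM _ (Others (inl (inl t))) id) => s st.
- by apply: xi_Others; apply: contraTN st => /eqP[->]; rewrite ltnn.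
- by move=> l i j; exact: P_Others.
- by move=> l i j; exact: Q_Others.
Qed.

Let block_lt s k : (s < k * tau)%N -> (s %/ tau < k)%N.
Proof. by rewrite ltn_divLR. Qed.

(** The iterate at time k tau has used the projections of periods below [k] only, so the draw (k, l)
    is still fresh. *)
Let meas_X_P k l l' i j :
  measurable_fun setT (fun w : Others (inl (inr (k, l))) => xw w (k * tau)%N l' i j).
Proof.
apply: (proj1 (@meas_XM _ (Others (inl (inr (k, l)))) id (k * tau)%N _ _ _)) => s /block_lt sk.
- exact: xi_Others.
- move=> l1 i1 j1; apply: P_Others.
  by apply: contraTN sk => /eqP[-> _]; rewrite ltnn.
- by move=> l1 i1 j1; apply: Q_Others.
Qed.

Let meas_X_Q k l l' i j :
  measurable_fun setT (fun w : Others (inr (k, l)) => xw w (k * tau)%N l' i j).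
Proof.
apply: (proj1 (@meas_XM _ (Others (inr (k, l))) id (k * tau)%N _ _ _)) => s /block_lt sk.
- exact: xi_Others.
- by move=> l1 i1 j1; apply: P_Others.
- move=> l1 i1 j1; apply: Q_Others.
  by apply: contraTN sk => /eqP[-> _]; rewrite ltnn.
Qed.

Let meas_flat (d : measure_display) (T : measurableType d) (Y : T -> @param R NL m n) :
  (forall l i j, measurable_fun setT (fun w => Y w l i j)) ->
  forall p, measurable_fun setT (fun w => flat (Y w) p).
Proof. by move=> mY p; under eq_fun do rewrite ffunE; exact: mY. Qed.

Let meas_Omega t :
  (forall l i j, measurable_fun setT (fun w => xw w t l i j)) /\
  (forall l i j, measurable_fun setT (fun w => momw w t l i j)).
Proof.
apply: (@meas_XM _ Omega id) => s st.
- exact: xi_meas.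
- by move=> l i j; have [h _] := P_unif (s %/ tau)%N l; exact: h.
- by move=> l i j; have [h _] := Q_unif (s %/ tau)%N l; exact: h.
Qed.

Let pr_meas (d : measure_display) (T : measurableType d) (phi : T -> Omega) k
    (V : T -> pvec R m n) :
  (forall l i j, measurable_fun setT (fun w => Pdraw k l (phi w) i j)) ->
  (forall l i j, measurable_fun setT (fun w => Qdraw k l (phi w) i j)) ->
  (forall p, measurable_fun setT (fun w => V w p)) ->
  forall p, measurable_fun setT (fun w => pr k (phi w) (V w) p).
Proof.
move=> mP mQ mV; apply: meas_flat => l; apply: measurable_lproj => //.
by move=> i j; under eq_fun do rewrite mxE; exact: mV.
Qed.

Let P_orth k l w : (Pdraw k l w)^T *m Pdraw k l w = 1%:M.
Proof. by have [_ [h _]] := P_unif k l; exact: h. Qed.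
Let Q_orth k l w : (Qdraw k l w)^T *m Qdraw k l w = 1%:M.
Proof. by have [_ [h _]] := Q_unif k l; exact: h. Qed.

Let pr_idem k w v : pr k w (pr k w v) = pr k w v.
Proof.
by apply: vproj_idempotent => l; [exact: P_orth|exact: Q_orth].
Qed.

Let pr_contract k w v : vdot (pr k w v) (pr k w v) <= vdot v v.
Proof.
have e : vdot (pr k w v) (pr k w v) = vdot (pr k w v) v.
  transitivity (vdot v (pr k w (pr k w v))); first exact: vproj_selfadjoint.
  by rewrite pr_idem vdotC.
have := vdot_ge0 (v + (-1) *: pr k w v).
rewrite vdotDl vdotZl !(vdotC _ (v + _)) !vdotDl !vdotZl e (vdotC v).
by lra.
Qed.

Let gf_lip2 y z :
  vdot (flat (gf y) - flat (gf z)) (flat (gf y) - flat (gf z)) <=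
  L ^+ 2 * vdot (flat y - flat z) (flat y - flat z).
Proof.
rewrite -!flat_sub -!pnorm2E.
have := gf_lip y z.
have h0 v : 0 <= pnorm2 v by rewrite pnorm2E vdot_ge0.
rewrite -ler_sqr ?nnegrE ?mulr_ge0 ?sqrtr_ge0 ?(ltW L0) //.
by rewrite exprMn !sqr_sqrtr ?h0.
Qed.

Let sqint_cst (v : pvec R m n) : sqint P (fun=> v).
Proof. by split=> [p|]; [exact: measurable_cst|exact: intg_cst]. Qed.

Let sqint_G t : sqint P (X t) -> sqint P (G t).
Proof.
move=> hX.
have hd : sqint P (fun w => X t w + (-1) *: flat x0) by apply: sqintD.
apply: (@sqint_le _ _ _ _ _ _ _ _ (fun w =>
   2 * (L ^+ 2 * vdot (X t w + (-1) *: flat x0) (X t w + (-1) *: flat x0)) +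
   2 * vdot (flat (gf x0)) (flat (gf x0)))).
- by apply: meas_flat; apply: gf_meas; case: (meas_Omega t).
- apply: intgD; last exact: intg_cst.
  by apply: intgZ; apply: intgZ; case: hd.
- move=> w.
  have {1 2}-> : G t w = (G t w - flat (gf x0)) + flat (gf x0) by rewrite subrK.
  apply: le_trans (vdotDD_le _ _) _; rewrite lerD2r ler_pM2l //.
  by rewrite scaleN1r; exact: gf_lip2.
Qed.

Let noise_hyps t S B : measurable (S : set (Others (inl (inl t)))) -> measurable B ->
  (P ((id @^-1` S) `&` (xi t @^-1` B)) = P (id @^-1` S) * D B)%E.
Proof.
by move=> mS mB; rewrite -(xi_law t mB); apply: indep_Others => //; exists B.
Qed.

Let gF_joint t l i j : measurable_fun setT
  (fun z : Others (inl (inl t)) * Xi => gF (xw z.1 t) z.2 l i j).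
Proof.
apply: gF_meas; last exact: measurable_snd.
move=> l' i' j'; have [h _] := meas_XM_xi t.
by apply: (@measurableT_comp _ _ _ _ _ _ (fun w : Others (inl (inl t)) => xw w t l' i' j')
   setT (@fst (Others (inl (inl t))) Xi)).
Qed.

Let gf_past t l i j : measurable_fun setT
  (fun w : Others (inl (inl t)) => gf (xw w t) l i j).
Proof. by apply: gf_meas; case: (meas_XM_xi t). Qed.

Let sqint_Nz t : sqint P (Nz t).
Proof.
exact: (sqint_noise (x := fun w : Others (inl (inl t)) => xw w t)
  (@id_Others (inl (inl t))) (xi_meas t) (@noise_hyps t)
  (@gF_joint t) (@gf_past t) gF_var).
Qed.

Let Ex_Nz t : Ex P (fun w => vdot (Nz t w) (Nz t w)) <= \sum_l sig l ^+ 2.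
Proof.
exact: (Ex_noise_le (x := fun w : Others (inl (inl t)) => xw w t)
  (@id_Others (inl (inl t))) (xi_meas t) (@noise_hyps t)
  (@gF_joint t) (@gf_past t) gF_var).
Qed.

Let MS t w : M t.+1 w =
  pr (t %/ tau)%N w ((1 - beta1) *: M t w + beta1 *: (G t w + Nz t w)).
Proof.
rewrite /pr /vproj /M; congr flat; apply: functional_extensionality_dep => l.
rewrite /momw golore_momS; congr (golore_proj _ _ _ _ l).
rewrite -[LHS]flatK; congr unflat.
rewrite flat_add !flat_scale; congr (_ + _ *: _).
by rewrite /G /Nz flat_sub addrC subrK.
Qed.

Let XS t w : X t.+1 w = X t w - eta *: M t.+1 w.
Proof.
rewrite /X /M -flat_scale -flat_sub; congr flat.
by apply: functional_extensionality_dep => l; rewrite /xw golore_xS.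
Qed.

Let sqint_pr k V : sqint P V -> sqint P (fun w => pr k w (V w)).
Proof.
move=> [mV iV]; apply: (sqint_le _ iV) => [|w]; last exact: pr_contract.
apply: (@pr_meas _ Omega id) => // l i j.
  by have [h _] := P_unif k l; exact: h.
by have [h _] := Q_unif k l; exact: h.
Qed.

Let M0 w : M 0 w = 0.
Proof.
by apply/ffunP => p; rewrite !ffunE /momw golore_mom0 mxE.
Qed.

Let sqint_XM t : sqint P (X t) /\ sqint P (M t).
Proof.
elim: t => [|t [hX hM]].
  split; first exact: (sqint_cst (flat x0)).
  by rewrite (_ : M 0 = fun=> 0); [exact: sqint_cst|apply/funext].
have hM' : sqint P (M t.+1).
  rewrite (_ : M t.+1 = fun w => pr (t %/ tau)%N w
     ((1 - beta1) *: M t w + beta1 *: (G t w + Nz t w))); last exact/funext/MS.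
  apply: sqint_pr; apply: sqintD; apply: sqintZ => //.
  by apply: sqintD; [exact: sqint_G|exact: sqint_Nz].
split => //.
rewrite (_ : X t.+1 = fun w => X t w + (- eta) *: M t.+1 w); last first.
  by apply/funext => w; rewrite XS scaleNr.
by apply: sqintD => //; exact: sqintZ.
Qed.

Let sqG t : sqint P (G t). Proof. by apply: sqint_G; case: (sqint_XM t). Qed.

Let sqU t : sqint P (U t).
Proof.
apply: sqint_pr.
rewrite (_ : (fun w => _) = fun w => M t w + (-1) *: G t w); last first.
  by apply/funext => w; rewrite scaleN1r.
by apply: sqintD; [case: (sqint_XM t)|exact: sqintZ].
Qed.

(** The projection inside [U t] is that of the current period, but it is drawn separately from the
    sample of time [t]; so [U t] is a function of the other draws. *)
Let Ex_cross t : Ex P (fun w => vdot (U t w) (Nz t w)) = 0.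
Proof.
apply: (Ex_vdot_noise (x := fun w : Others (inl (inl t)) => xw w t)
  (@id_Others (inl (inl t))) (xi_meas t) (@noise_hyps t)
  (@gF_joint t) (@gf_past t) gF_int gF_mean gF_var (u := U t)); last exact: sqU.
apply: (@pr_meas _ (Others (inl (inl t))) id).
- by move=> l i j; exact: P_Others.
- by move=> l i j; exact: Q_Others.
- have [hX hM] := meas_XM_xi t.
  have mM := meas_flat hM; have mG := meas_flat (@gf_past t).
  move=> p; rewrite (_ : (fun w => _) = fun w => flat (momw w t) p - flat (gf (xw w t)) p).
    by apply: measurable_funB; [exact: mM|exact: mG].
  by apply/funext => w; rewrite !ffunE.
Qed.

Let layer k l w : 'M[R]_(m l, n l) := gf (xw w (k * tau)%N) l.

Let intg_layer k l : intg P (fun w => frob2 (layer k l w)).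
Proof.
apply: (intg_le _ (sqG (k * tau)%N).2).
  apply: measurable_frob2 => i j; apply: gf_meas.
  by case: (meas_Omega (k * tau)%N).
move=> w; rewrite ger0_norm ?frob2_ge0 // -pnorm2E /pnorm2 (bigD1 l) //= lerDl.
by apply: sumr_ge0 => l' _; exact: frob2_ge0.
Qed.

Let layer_residual k l :
  intg P (fun w => frob2 (layer k l w -
    lproj (Pdraw k l w) (Qdraw k l w) (layer k l w))) /\
  Ex P (fun w => frob2 (layer k l w -
    lproj (Pdraw k l w) (Qdraw k l w) (layer k l w))) =
  (1 - delta_l R (r l) (m l) (n l)) * Ex P (fun w => frob2 (layer k l w)).
Proof.
rewrite /lproj /delta_l; case: leqP => mn.
  have ind S B : measurable (S : set (Others (inl (inr (k, l))))) ->
      @mx_events R (m l) (r l) B ->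
      (P ((id @^-1` S) `&` (Pdraw k l @^-1` B)) =
       P (id @^-1` S) * P (Pdraw k l @^-1` B))%E.
    by move=> mS mB; apply: (indep_Others mS); exists B.
  have ma i j : measurable_fun setT
      (fun w : Others (inl (inr (k, l))) => layer k l w i j).
    by apply: gf_meas => l' i' j'; exact: meas_X_P.
  have h1 := intg_residual (P_unif k l) (@id_Others (inl (inr (k, l)))).
  have h2 := Ex_residual (P_unif k l) (@id_Others (inl (inr (k, l)))) ind.
  by split; [exact: (h1 _ _ ma (intg_layer k l))|exact: (h2 _ _ ma (intg_layer k l))].
(* For m > n the projection acts on the right; transposing makes it a left projection and keeps the
   Frobenius norm. *)
have ind S B : measurable (S : set (Others (inr (k, l)))) ->
    @mx_events R (n l) (r l) B ->
    (P ((id @^-1` S) `&` (Qdraw k l @^-1` B)) =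
     P (id @^-1` S) * P (Qdraw k l @^-1` B))%E.
  by move=> mS mB; apply: (indep_Others mS); exists B.
have ma i j : measurable_fun setT
    (fun w : Others (inr (k, l)) => (layer k l w)^T i j).
  under eq_fun do rewrite mxE.
  by apply: gf_meas => l' i' j'; exact: meas_X_Q.
have ia : intg P (fun w => frob2 (layer k l w)^T).
  by under [fun w => _]eq_fun do rewrite frob2_trmx; exact: intg_layer.
have resE w : frob2 (layer k l w - layer k l w *m Qdraw k l w *m (Qdraw k l w)^T)
  = frob2 ((layer k l w)^T - Qdraw k l w *m ((Qdraw k l w)^T *m (layer k l w)^T)).
  by rewrite -frob2_trmx linearB /= !trmx_mul trmxK.
under [fun w => frob2 (_ - _)]eq_fun do rewrite resE.
have h1 := intg_residual (Q_unif k l) (@id_Others (inr (k, l))).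
have h2 := Ex_residual (Q_unif k l) (@id_Others (inr (k, l))) ind.
split; first exact: (h1 _ _ ma ia).
rewrite (h2 _ _ ma ia).
by under [fun w => frob2 _^T]eq_fun do rewrite frob2_trmx.
Qed.

Variable delta : R.
Hypothesis delta_le : forall l, delta <= delta_l R (r l) (m l) (n l).

Let res k w : R := vdot (G (k * tau)%N w - pr k w (G (k * tau)%N w))
                        (G (k * tau)%N w - pr k w (G (k * tau)%N w)).

Let resE k w : res k w = \sum_l frob2 (layer k l w -
    lproj (Pdraw k l w) (Qdraw k l w) (layer k l w)).
Proof. by rewrite /res /pr /vproj /G flatK -flat_sub -pnorm2E. Qed.

Let intg_res k : intg P (res k).
Proof.
have -> : res k = _ := funext (resE k).
by apply: intg_sum => l; case: (layer_residual k l).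
Qed.

Let Ex_res k : Ex P (res k) <=
  (1 - delta) * Ex P (fun w => vdot (G (k * tau)%N w) (G (k * tau)%N w)).
Proof.
have -> : res k = _ := funext (resE k).
rewrite (_ : (fun w => vdot _ _) = fun w => \sum_l frob2 (layer k l w)); last first.
  by apply/funext => w; rewrite -pnorm2E.
rewrite !Ex_sum => [|l|l]; [|exact: intg_layer|by case: (layer_residual k l)].
rewrite mulr_sumr; apply: ler_sum => l _.
have [_ ->] := layer_residual k l.
rewrite ler_wpM2r ?lerD2l ?lerN2 //.
rewrite -(Ex_cst P 0); apply: Ex_le => [||w]; [exact: intg_cst|exact: intg_layer|].
exact: frob2_ge0.
Qed.

Hypotheses (delta0 : 0 < delta) (delta1 : delta <= 1).
Hypotheses (beta_gt0 : 0 < beta1) (beta_le1 : beta1 <= 1) (eta0 : 0 < eta).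
Hypothesis tau_large : 64 / (3 * beta1 * delta) <= tau%:R.
Hypothesis eta_L : 4 * (eta * L) <= 1.
Hypothesis eta_beta : 80 * (L ^+ 2 * eta ^+ 2) <= 3 * delta * beta1 ^+ 2.
Hypothesis eta_tau : 80 * (tau%:R ^+ 2 * (L ^+ 2 * eta ^+ 2)) <= 3 * delta.
Hypothesis eta_tau_beta : 16 * (tau%:R * (L ^+ 2 * eta ^+ 2)) <= 3 * beta1.

Let Delta := f x0 - inf (range f).

Let f_gap x : f x0 - f x <= Delta.
Proof.
rewrite lerD2l lerN2; apply: ge_inf; last by exists x.
by have [c hc] := f_lower; exists c => _ [y _ <-].
Qed.

Let pathwise K w :
  delta / 8 * \sum_(0 <= t < K * tau) vdot (G t w) (G t w) <=
  2 * Delta / eta +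
  \sum_(0 <= t < K * tau)
    (2 * (1 - beta1) * vdot (U t w) (Nz t w) + beta1 * vdot (Nz t w) (Nz t w)) +
  tau%:R * (1 + delta / 4) *
  \sum_(0 <= k < K)
    (res k w - (1 - delta) * vdot (G (k * tau)%N w) (G (k * tau)%N w)).
Proof.
apply: (@pathwise_gradient_bound R (pvec R m n) (@vdot R NL m n) (@vdotC _ _ _ _)
  (@vdotDl _ _ _ _) (@vdotZl _ _ _ _) (@vdot_ge0 _ _ _ _)
  (X ^~ w) (G ^~ w) (Nz ^~ w) (M ^~ w) (pr ^~ w) (fun t => f (xw w t))
  tau beta1 eta L delta Delta) => //.
- by move=> k a b; exact: vproj_add.
- by move=> k c a; exact: vproj_scale.
- by move=> k a b; exact: vproj_selfadjoint.
- by move=> s t; exact: gf_lip2.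
- move=> t.
  have := @descent_lemma R (pvec R m n) (@vdot R NL m n) (@vdotC _ _ _ _)
    (@vdotDl _ _ _ _) (@vdotZl _ _ _ _) (@vdot_ge0 _ _ _ _)
    (fun v => f (unflat v)) (fun v => flat (gf (unflat v))) L L0
    (is_gradient_flat gf_grad) _ (X t w) (X t.+1 w - X t w).
  rewrite addrC subrK /X !flatK; apply => v u.
  by have := gf_lip2 (unflat v) (unflat u); rewrite !unflatK.
Qed.

(** In mean the cross terms vanish, and the excess terms are nonpositive with a nonnegative
    coefficient, so they are dropped. *)
Lemma golore_expected_bound K :
  delta / 8 * \sum_(0 <= t < K * tau) Ex P (fun w => vdot (G t w) (G t w)) <=
  2 * Delta / eta + (K * tau)%:R * (beta1 * \sum_l sig l ^+ 2).
Proof.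
have iG t : intg P (fun w => vdot (G t w) (G t w)) by case: (sqG t).
have iN t : intg P (fun w => vdot (Nz t w) (Nz t w)) by case: (sqint_Nz t).
have iU t : intg P (fun w => vdot (U t w) (Nz t w)).
  exact: intg_vdot (sqU t) (sqint_Nz t).
have iz t : intg P (fun w => 2 * (1 - beta1) * vdot (U t w) (Nz t w)
                            + beta1 * vdot (Nz t w) (Nz t w)).
  by apply: intgD; exact: intgZ.
have iy k : intg P (fun w => res k w + (- (1 - delta)) *
    vdot (G (k * tau)%N w) (G (k * tau)%N w)).
  by apply: intgD => //; exact: intgZ.
rewrite -Ex_sum // -ExZ; last exact: intg_sum.
pose Z w := \sum_(0 <= t < K * tau)
    (2 * (1 - beta1) * vdot (U t w) (Nz t w) + beta1 * vdot (Nz t w) (Nz t w)).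
pose Y w := \sum_(0 <= k < K) (res k w + (- (1 - delta)) *
    vdot (G (k * tau)%N w) (G (k * tau)%N w)).
have iZ : intg P Z by exact: intg_sum.
have iY : intg P Y by exact: intg_sum.
have iR : intg P (fun w => 2 * Delta / eta + Z w + tau%:R * (1 + delta / 4) * Y w).
  by apply: intgD; [apply: intgD => //; exact: intg_cst|exact: intgZ].
apply: (le_trans (Ex_le _ iR _)).
- by apply: intgZ; exact: intg_sum.
- move=> w; apply: le_trans (pathwise K w) _; rewrite lerD2l ler_wpM2l //.
    by rewrite mulr_ge0 // addr_ge0 ?divr_ge0 // ltW.
  by apply: ler_sum => k _; rewrite mulNr.
rewrite ExD; [|by apply: intgD => //; exact: intg_cst|exact: intgZ].
rewrite ExD //; last exact: intg_cst.
rewrite (Ex_cst P (2 * Delta / eta)) ExZ // -addrA lerD2l.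
have Zle : Ex P Z <= (K * tau)%:R * (beta1 * \sum_l sig l ^+ 2).
  rewrite /Z Ex_sum //.
  have -> : (K * tau)%:R * (beta1 * \sum_l sig l ^+ 2) =
     \sum_(0 <= t < K * tau) beta1 * \sum_l sig l ^+ 2.
    by rewrite sumr_const_nat subn0 -[RHS]mulr_natl.
  apply: ler_sum => t _.
  rewrite ExD; [|exact: intgZ|exact: intgZ].
  rewrite ExZ // ExZ // Ex_cross mulr0 add0r ler_pM2l //.
have Yle : Ex P Y <= 0.
  rewrite /Y Ex_sum //; apply: sumr_le0 => k _.
  rewrite ExD //; last exact: intgZ.
  by rewrite ExZ // mulNr subr_le0.
rewrite -[X in _ <= X]addr0; apply: lerD => //.
by rewrite mulr_ge0_le0 // mulr_ge0 // addr_ge0 ?divr_ge0 // ltW.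
Qed.

Lemma golore_sum_integral T :
  (\sum_(0 <= t < T) \int[P]_w (pnorm2 (gf (xw w t)))%:E =
   (\sum_(0 <= t < T) Ex P (fun w => vdot (G t w) (G t w)))%:E)%E.
Proof.
rewrite -sumEFin; apply: eq_bigr => t _; rewrite -ExE; last by case: (sqG t).
by apply: eq_integral => w _; rewrite pnorm2E.
Qed.
End Convergence.

Unset Implicit Arguments.
Set Strict Implicit.

Theorem theoremB4
  (R : realType)
  (* layers and dimensions *)
  (NL : nat) (m n r : 'I_NL -> nat)
  (* data distribution D on the sample space Xi *)
  (dX : measure_display) (Xi : measurableType dX) (D : probability Xi R)
  (* F(x; xi), grad F(x; xi), f, grad f *)
  (F : @param R NL m n -> Xi -> R) (gF : @param R NL m n -> Xi -> @param R NL m n)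
  (f : @param R NL m n -> R) (gf : @param R NL m n -> @param R NL m n)
  (L : R) (sig : 'I_NL -> R)
  (* underlying probability space and the random draws *)
  (dO : measure_display) (Omega : measurableType dO) (P : probability Omega R)
  (xi : nat -> Omega -> Xi)
  (Pdraw : nat -> forall l : 'I_NL, Omega -> 'M[R]_(m l, r l))
  (Qdraw : nat -> forall l : 'I_NL, Omega -> 'M[R]_(n l, r l))
  (* algorithm parameters *)
  (x0 : @param R NL m n) (beta1 eta : R) (tau : nat) :
  (* f(x) = E_xi F(x; xi), and grad F(.; xi) is the gradient of F(.; xi) *)
  (forall x, D.-integrable setT (fun s => (F x s)%:E)) ->
  (forall x, ((f x)%:E = \int[D]_s (F x s)%:E)%E) ->
  (forall s, is_gradient (fun x => F x s) (fun x => gF x s)) ->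
  (* grad f is the gradient of f *)
  is_gradient f gf ->
  (* the stochastic gradient oracle is (jointly) measurable *)
  (forall (Y : Omega -> @param R NL m n) (Z : Omega -> Xi),
      (forall l i j, measurable_fun setT (fun w => Y w l i j)) ->
      measurable_fun setT Z ->
      forall l i j, measurable_fun setT (fun w => gF (Y w) (Z w) l i j)) ->
  (* Assumption 1 *)
  (exists c : R, forall x, c <= f x) ->
  (* Assumption 2 *)
  lipschitz2 L gf ->
  (* Assumption 3 *)
  (forall x l i j, D.-integrable setT (fun s => (gF x s l i j)%:E)) ->
  (forall x l i j, (\int[D]_s (gF x s l i j)%:E = (gf x l i j)%:E)%E) ->
  (forall x l, (\int[D]_s (frob2 (gF x s l - gf x l))%:E <= (sig l ^+ 2)%:E)%E) ->
  (* xi^(t) ~ D, P_l ~ U(St_{m_l, r_l}), Q_l ~ U(St_{n_l, r_l}), all independent *)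
  (forall t, measurable_fun setT (xi t)) ->
  (forall t A, measurable A -> P (xi t @^-1` A) = D A) ->
  (forall k l, uniform_stiefel P (Pdraw k l)) ->
  (forall k l, uniform_stiefel P (Qdraw k l)) ->
  mutually_independent P (golore_sigmas xi Pdraw Qdraw) ->
  (* rank condition *)
  (forall l, (0 < r l)%N /\ (r l < minn (m l) (n l))%N) ->
  (* hyperparameters *)
  let delta := \big[Order.min/1]_(l < NL) delta_l R (r l) (m l) (n l) in
  let sigma2 := \sum_(l < NL) sig l ^+ 2 in
  let Delta := f x0 - inf (range f) in
  0 < beta1 -> beta1 <= 1 ->
  (0 < tau)%N ->
  64 / (3 * beta1 * delta) <= tau%:R ->
  0 < eta ->
  eta <= (4 * L)^-1 ->
  eta <= Num.sqrt (3 * delta * beta1 ^+ 2 / (80 * L ^+ 2)) ->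
  eta <= Num.sqrt (3 * delta / (80 * tau%:R ^+ 2 * L ^+ 2)) ->
  eta <= Num.sqrt (3 * beta1 / (16 * tau%:R * L ^+ 2)) ->
  (* conclusion, for every K >= 1 *)
  forall K : nat, (0 < K)%N ->
    let x := fun (w : Omega) (t : nat) =>
      golore_x beta1 eta tau gF x0 (fun t => xi t w)
               (fun k l => Pdraw k l w) (fun k l => Qdraw k l w) t in
    ((((K * tau)%:R)^-1)%:E *
      (\sum_(0 <= t < K * tau) \int[P]_w (pnorm2 (gf (x w t)))%:E)
    <= (16 * Delta / (delta * eta * (K * tau)%:R) + 32 * beta1 * sigma2 / (3 * delta))%:E)%E.
Proof.
move=> F_int _ gF_grad gf_grad _ f_lower gf_lip gF_int gF_mean gF_var.
move=> xi_meas xi_law P_unif Q_unif indep rank delta sigma2 Delta.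
move=> b0 b1 tau0 tau_large e0 e1 e2 e3 e4 K K0; cbv beta zeta.
(* A nonpositive [L] would make (4 L)^-1 nonpositive, the inverse of 0 being 0, against 0 < eta. *)
have L0 : 0 < L.
  by have := lt_le_trans e0 e1; rewrite invr_gt0 pmulr_rgt0.
have dl l : 0 < delta_l R (r l) (m l) (n l).
  have [r0 rmn] := rank l.
  by rewrite divr_gt0 ?ltr0n // (leq_ltn_trans _ rmn).
have d0 : 0 < delta.
  rewrite /delta; elim/big_ind: _ => // a b a0 b0'.
  by rewrite lt_min a0.
(* 1 is the initial value of the minimum, so this holds even without layers. *)
have d1 : delta <= 1 by exact: bigmin_le_id.
have dle l : delta <= delta_l R (r l) (m l) (n l) by exact: bigmin_le.
have sq_le (a : R) : eta <= Num.sqrt a -> eta ^+ 2 <= a.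
  (* [Num.sqrt] vanishes on nonpositive reals, so 0 < eta forces a > 0. *)
  move=> ha; have a0 : 0 < a by rewrite -sqrtr_gt0 (lt_le_trans e0).
  by rewrite -[leRHS]sqr_sqrtr ?(ltW a0) // ler_sqr ?nnegrE ?sqrtr_ge0 ?(ltW e0).
have L2 : 0 < L ^+ 2 by rewrite exprn_gt0.
have t0 : (0 : R) < tau%:R by rewrite ltr0n.
have h1 : 4 * (eta * L) <= 1.
  by move: e1; rewrite -[_^-1]mul1r ler_pdivlMr ?mulr_gt0 // mulrCA.
have h2 : 80 * (L ^+ 2 * eta ^+ 2) <= 3 * delta * beta1 ^+ 2.
  move: (sq_le _ e2); rewrite ler_pdivlMr ?mulr_gt0 //; lra.
have h3 : 80 * (tau%:R ^+ 2 * (L ^+ 2 * eta ^+ 2)) <= 3 * delta.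
  move: (sq_le _ e3); rewrite ler_pdivlMr ?mulr_gt0 ?exprn_gt0 //; lra.
have h4 : 16 * (tau%:R * (L ^+ 2 * eta ^+ 2)) <= 3 * beta1.
  move: (sq_le _ e4); rewrite ler_pdivlMr ?mulr_gt0 //; lra.
have bound := golore_expected_bound x0 F_int gF_grad gf_grad f_lower gf_lip
  gF_int gF_mean gF_var xi_meas xi_law P_unif Q_unif indep L0 tau0 dle d0 d1
  b0 b1 e0 tau_large h1 h2 h3 h4 K.
rewrite (golore_sum_integral x0 beta1 eta tau F_int gF_grad gf_grad gf_lip
  gF_var xi_meas xi_law P_unif Q_unif indep L0 (K * tau)) -EFinM lee_fin.
set S := \sum_(0 <= t < _) _; set KT := (K * tau)%:R.
have KT0 : 0 < KT :> R by rewrite ltr0n muln_gt0 K0.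
have {}bound : delta / 8 * S <= 2 * Delta / eta + KT * (beta1 * sigma2) by [].
clearbody KT S.
have s0 : 0 <= sigma2 by apply: sumr_ge0 => l _; exact: sqr_ge0.
have dS : S = 8 / delta * (delta / 8 * S) by field; rewrite gt_eqF.
rewrite mulrC ler_pdivrMr // dS.
(* Multiplying by 8 / delta produces the stated Delta term exactly, and 8 beta sigma^2 / delta for
   the variance; the constant 32 / 3 is 4 / 3 times this 8. *)
apply: (@le_trans _ _ (8 / delta * (2 * Delta / eta + KT * (beta1 * sigma2)))).
  by rewrite ler_pM2l // divr_gt0.
have -> : (16 * Delta / (delta * eta * KT) + 32 * beta1 * sigma2 / (3 * delta)) * KT =
  8 / delta * (2 * Delta / eta + (4 / 3) * (KT * (beta1 * sigma2))).
  by field; rewrite (gt_eqF e0) (gt_eqF d0) (gt_eqF KT0).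
rewrite ler_pM2l ?divr_gt0 // lerD2l ler_peMl ?mulr_ge0 ?(ltW KT0) ?(ltW b0) //.
by rewrite ler_pdivlMr // mul1r ler_nat.
Qed.
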